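(* Let $\mathcal H_A,\mathcal H_B$ be Hilbert spaces of finite dimensions $d_A,d_B$, and let $D=d_Ad_B$. For any two states $\rho,\sigma$ on $\mathcal H_A\otimes\mathcal H_B$, let $\xi=\rho-\sigma$. Then $$\|\xi\|_{\mathcal U_A\otimes\mathcal U_B}\ \ge\ \frac1{\sqrt{153}}\,\|\xi\|_2\ \ge\ \frac1{\sqrt{153\,D}}\,\|\xi\|_1 .$$ Consequently, $\lambda(\mathcal U_A\otimes\mathcal U_B)\ge 1/\sqrt{153\,D}$.
   Context: A state is a positive semidefinite operator of trace $1$. $\|\cdot\|_1$ is the trace norm and $\|\xi\|_2=\sqrt{\operatorname{Tr}(\xi^\dagger\xi)}$ the Hilbert–Schmidt norm. $\mathcal U_A$ and $\mathcal U_B$ denote the isotropic (uniform) POVMs $\bigl(d_A|\varphi\rangle\langle\varphi|\,\mathrm d\varphi\bigr)$ on $\mathcal H_A$ and $\bigl(d_B|\psi\rangle\langle\psi|\,\mathrm d\psi\bigr)$ on $\mathcal H_B$, with $\mathrm d\varphi,\mathrm d\psi$ the normalised unitarily invariant measures on unit vectors, and $\mathcal U_A\otimes\mathcal U_B$ is the tensor product POVM $\bigl(D\,|\varphi\rangle\langle\varphi|\otimes|\psi\rangle\langle\psi|\,\mathrm d\varphi\,\mathrm d\psi\bigr)$. Its associated norm on Hermitian operators is $$\|\xi\|_{\mathcal U_A\otimes\mathcal U_B}=D\int\!\!\int\mathrm d\varphi\,\mathrm d\psi\ \bigl|\operatorname{Tr}\bigl(\xi\,(|\varphi\rangle\langle\varphi|\otimes|\psi\rangle\langle\psi|)\bigr)\bigr|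 .$$ $\lambda(\mathcal U_A\otimes\mathcal U_B)$ is the largest real number $\lambda$ such that $\lambda\|\xi\|_1\le\|\xi\|_{\mathcal U_A\otimes\mathcal U_B}$ for all Hermitian $\xi$ on $\mathcal H_A\otimes\mathcal H_B$ with $\operatorname{Tr}\xi=0$. *)

(* Defs.v *)
From HB Require Import structures.
From mathcomp Require Import all_boot all_order all_algebra.
From mathcomp Require Import sesquilinear spectral complex mxtens.
From mathcomp Require Import all_classical all_reals all_analysis.

Set Implicit Arguments.
Unset Strict Implicit.
Unset Printing Implicit Defensive.

Import Order.TTheory GRing.Theory Num.Theory.
Local Open Scope classical_set_scope.
Local Open Scope ring_scope.
Local Open Scope sesquilinear_scope.

(* The Hilbert space of dimension d is C^d with C = R[i], its vectors are the
   columns 'cV[R[i]]_d, and the tensor product of C^dA and C^dB is C^(dA * dB)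
   through the Kronecker product *t. *)

Section Operators.
Variable R : realType.
Local Notation C := R[i].

Definition psdmx n (A : 'M[C]_n) : Prop :=
  A \is hermsymmx /\ forall v : 'cV[C]_n, 0 <= (v^t* *m A *m v) 0 0.

Definition is_state n (rho : 'M[C]_n) : Prop := psdmx rho /\ \tr rho = 1.

(* The square root of a positive semidefinite A: [A = P^-1 diag(s) P] with P
   unitary is replaced by [P^-1 diag(sqrt s) P]. *)
Definition sqrtmx n (A : 'M[C]_n) : 'M[C]_n :=
  invmx (spectralmx A) *m diag_mx (map_mx sqrtC (spectral_diag A))
    *m spectralmx A.

(* [complex.Re] is the real part with values in R; the traces below are
   nonnegative real elements of C. *)
Definition trnorm n (A : 'M[C]_n) : R := complex.Re (\tr (sqrtmx (A^t* *m A))).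

Definition hsnorm n (A : 'M[C]_n) : R :=
  Num.sqrt (complex.Re (\tr (A^t* *m A))).

Definition ketbra n (phi : 'cV[C]_n) : 'M[C]_n := phi *m phi^t*.

End Operators.

HB.instance Definition _ (R : realType) := isPointed.Build R[i] 0.

Section IsotropicMeasure.
Variables (R : realType) (d : nat).
Local Notation C := R[i].

(* Sets depending on the real and imaginary parts of one coordinate only, with
   a Borel condition on these; they generate the Borel sigma-algebra of C^d. *)
Definition coord_sets : set (set 'cV[C]_d) :=
  \bigcup_(i in [set: 'I_d])
    preimage_set_system setT
      (fun v : 'cV[C]_d => (complex.Re (v i 0), complex.Im (v i 0)))
      (measurable : set (set (R * R)%type)).

Definition cspace := g_sigma_algebraType coord_sets.

Definition unit_vectors : set cspace :=
  [set v : 'cV[C]_d | (v^t* *m v) 0 0 = 1].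

(* The normalised unitarily invariant measure on the unit vectors of C^d, seen
   as a probability measure on C^d carried by the unit vectors. *)
Definition isotropic (mu : probability cspace R) : Prop :=
  mu unit_vectors = 1%E /\
  forall (U : 'M[C]_d) (A : set cspace), U \is unitarymx -> measurable A ->
    mu [set v : 'cV[C]_d | A (U *m v)] = mu A.

End IsotropicMeasure.
Arguments unit_vectors : clear implicits.

Section UniformPOVM.
Variables (R : realType) (dA dB : nat).
Variables (muA : probability (cspace R dA) R) (muB : probability (cspace R dB) R).
Local Notation C := R[i].

Definition UUnorm (xi : 'M[C]_(dA * dB)) : R :=
  (dA * dB)%:R *
  \int[muA]_(phi in unit_vectors R dA) \int[muB]_(psi in unit_vectors R dB)
    Normc.normc (\tr (xi *m (ketbra phi *t ketbra psi))).

Definition admissible (l : R) : Prop :=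
  forall xi : 'M[C]_(dA * dB), xi \is hermsymmx -> \tr xi = 0 ->
    l * trnorm xi <= UUnorm xi.

(* The largest admissible real number (lambda_largest). When dA = dB = 1 every
   real number is admissible, there is no largest one, and lambda is +oo. *)
Definition lambda : \bar R := ereal_sup [set l%:E | l in admissible].

End UniformPOVM.

Lemma psdmx_spectral_diag_ge0 (R : realType) n (A : 'M[R[i]]_n) (i : 'I_n) :
  psdmx A -> 0 <= spectral_diag A 0 i.
Proof.
move=> [Ah A0].
have /orthomx_spectralP AE := hermitian_normalmx Ah.
have Pu := spectral_unitarymx A.
set P := spectralmx A in AE Pu *.
have PK m (B : 'M[R[i]]_(n, m)) : P *m (P^t* *m B) = B.
  by rewrite mulmxA (unitarymxP Pu) mul1mx.
have := A0 (P^t* *m delta_mx i 0).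
rewrite trmx_mul map_mxM trmxCK.
rewrite [X in _ *m X *m _]AE invmx_unitary// -!mulmxA.
rewrite !PK trmx_delta map_delta_mx -rowE.
by rewrite -colE !mxE eqxx mulr1n.
Qed.

Lemma sqrtmx_psd (R : realType) n (A : 'M[R[i]]_n) :
  psdmx A -> psdmx (sqrtmx A).
Proof.
move=> Apsd; have Pu := spectral_unitarymx A; rewrite /sqrtmx invmx_unitary//.
set P := spectralmx A in Pu *.
set s := map_mx sqrtC _.
have s0 i : 0 <= s 0 i by rewrite mxE sqrtC_ge0 psdmx_spectral_diag_ge0.
split.
  apply/is_hermitianmxP; rewrite expr0 scale1r !trmx_mul !map_mxM trmxCK.
  rewrite tr_diag_mx map_diag_mx mulmxA; congr (_ *m diag_mx _ *m _).
  by apply/rowP => i; rewrite [RHS]mxE; exact/esym/geC0_conj.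
move=> v; rewrite !mulmxA -(mulmxA _ P v) -[_ *m P^t*]trmxCK.
rewrite trmx_mul map_mxM !trmxCK !mxE; apply: sumr_ge0 => i _.
rewrite mul_mx_diag !mxE mulrAC mulr_ge0//.
  by rewrite mulrC mul_conjC_ge0.
by rewrite sqrtC_ge0 psdmx_spectral_diag_ge0.
Qed.

Lemma sqrtmxK (R : realType) n (A : 'M[R[i]]_n) :
  psdmx A -> sqrtmx A *m sqrtmx A = A.
Proof.
move=> Apsd.
have /orthomx_spectralP AE := hermitian_normalmx Apsd.1.
rewrite {3}AE /sqrtmx !mulmxA mulmxK ?spectral_unit//.
rewrite -[_ *m diag_mx _ *m diag_mx _]mulmxA mulmx_diag.
congr (_ *m diag_mx _ *m _).
by apply/rowP => i; rewrite !mxE -expr2 sqrtCK.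
Qed.

Lemma psdmx_gram (R : realType) n (A : 'M[R[i]]_n) : psdmx (A^t* *m A).
Proof.
split.
  by apply/is_hermitianmxP; rewrite expr0 scale1r trmx_mul map_mxM trmxCK.
move=> v; rewrite mulmxA -mulmxA -map_mxM -trmx_mul !mxE.
by apply: sumr_ge0 => i _; rewrite !mxE mulrC mul_conjC_ge0.
Qed.

Lemma trnorm_ge0 (R : realType) n (A : 'M[R[i]]_n) : 0 <= trnorm A.
Proof.
suff : 0 <= \tr (sqrtmx (A^t* *m A)) by rewrite lecE => /andP[].
apply: sumr_ge0 => i _.
have [_ /(_ (delta_mx i 0))] := sqrtmx_psd (psdmx_gram A).
by rewrite trmx_delta map_delta_mx -mulmxA -colE -rowE !mxE.
Qed.

Lemma lambda_largest (R : realType) (dA dB : nat)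
    (muA : probability (cspace R dA) R) (muB : probability (cspace R dB) R)
    (l : R) :
  lambda muA muB = l%:E <->
  admissible muA muB l /\ forall l' : R, admissible muA muB l' -> l' <= l.
Proof.
split=> [lE|[ladm lmax]].
  have lub l' : admissible muA muB l' -> l' <= l.
    by move=> adm; rewrite -lee_fin -lE; apply: ereal_sup_ubound; exists l'.
  split=> // xi xiH xi0.
  have [t0|t0] := eqVneq (trnorm xi) 0.
    rewrite t0 mulr0; apply: mulr_ge0; first exact: ler0n.
    apply: Rintegral_ge0 => phi _; apply: Rintegral_ge0 => psi _.
    by case: (\tr _) => a b; exact: sqrtr_ge0.
  have tp : 0 < trnorm xi by rewrite lt_def t0 trnorm_ge0.
  rewrite -ler_pdivlMr// -lee_fin -lE; apply: ge_ereal_sup => _ [l' adm <-].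
  by rewrite lee_fin ler_pdivlMr//; exact: adm.
apply/eqP; rewrite eq_le; apply/andP; split.
  by apply: ge_ereal_sup => _ [l' adm <-]; rewrite lee_fin lmax.
by apply: ereal_sup_ubound; exists l.
Qed.

(* Main.v *)
(* Write X(phi, psi) = Tr(xi (|phi><phi| (x) |psi><psi|)).  The L1 mean of X is
   bounded below through its second and fourth moments, by
   |x| >= (5/2) (x^2/tau - x^4/tau^3) for a suitable tau.

   For one party and a Hermitian M = diag(m_k), unitary invariance gives, for
   X = sum_k m_k |z_k|^2, the recursion
     (d + n) E[|z_i|^2 X^n] = E[X^n] + n m_i E[|z_i|^2 X^(n-1)],
   obtained by differentiating E[Re(z_i^* u z_j) X^n] along rotations of the
   coordinates i, j (|u| = 1) and summing over j.  Hence, with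
   W = (Tr M)^2 + Tr M^2, E[X^2] = W / (d (d + 1)) and
   E[X^4] <= 11 W^2 / (d (d + 1) (d + 2) (d + 3)).

   The two-party moments follow one party at a time: integrating psi out, W is
   a sum of squares of Hermitian forms in phi, and the Cauchy-Schwarz
   inequality controls the second moment of such a sum with the same constant
   11.  The total constant 11^2 leaves room for 153. *)

Require Import Defs.
From HB Require Import structures.
From mathcomp Require Import all_boot all_order all_algebra.
From mathcomp Require Import sesquilinear spectral complex mxtens.
From mathcomp Require Import all_classical all_reals all_analysis.
From mathcomp Require Import measurable_realfun ring lra.

Set Implicit Arguments.
Unset Strict Implicit.
Unset Printing Implicit Defensive.

Import Order.TTheory GRing.Theory Num.Theory.

Local Open Scope classical_set_scope.
Local Open Scope ring_scope.
Local Open Scope sesquilinear_scope.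

(** * Means over the unit sphere *)

Section SphereMean.
Variables (R : realType) (d : nat).
Local Notation C := R[i].
Local Notation V := (cspace R d).
Local Notation S := (unit_vectors R d).

Definition rcoord (i : 'I_d) (z : 'cV[C]_d) : R := complex.Re (z i 0).
Definition icoord (i : 'I_d) (z : 'cV[C]_d) : R := complex.Im (z i 0).
Definition sqcoord (i : 'I_d) (z : 'cV[C]_d) : R :=
  rcoord i z ^+ 2 + icoord i z ^+ 2.

Lemma measurable_coord (i : 'I_d) (B : set (R * R)) : measurable B ->
  measurable ([set z | B (rcoord i z, icoord i z)] : set V).
Proof.
move=> mB; apply: sub_sigma_algebra; exists i => //.
by exists B => //; rewrite setTI.
Qed.

Lemma measurable_rcoord i : measurable_fun [set: V] (rcoord i).
Proof.
move=> _ B mB; rewrite setTI.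
have := @measurable_coord i (B `*` setT) (measurableX mB measurableT).
by congr measurable; apply/seteqP; split => z //= [].
Qed.

Lemma measurable_icoord i : measurable_fun [set: V] (icoord i).
Proof.
move=> _ B mB; rewrite setTI.
have := @measurable_coord i (setT `*` B) (measurableX measurableT mB).
by congr measurable; apply/seteqP; split => z //= [].
Qed.

Lemma measurable_sqcoord i : measurable_fun [set: V] (sqcoord i).
Proof.
by apply: measurable_funD; apply: measurable_funX;
  [exact: measurable_rcoord|exact: measurable_icoord].
Qed.

Lemma unit_vectorsE : S = [set z | \sum_i sqcoord i z = 1].
Proof.
apply/seteqP; split => z; rewrite /unit_vectors /= !mxE.
all: rewrite (_ : \sum_j _ = (\sum_i sqcoord i z)%:C%C); last first.
1,3: rewrite raddf_sum; apply: eq_bigr => i _; rewrite !mxE /sqcoord /rcoord.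
1,2: by rewrite /icoord; case: (z i 0) => a b; rewrite /= /GRing.mul /=;
       congr (_ +i* _)%C; ring.
by case.
by move=> ->.
Qed.

Lemma measurable_unit_vectors : measurable (S : set V).
Proof.
rewrite unit_vectorsE.
have mf : measurable_fun [set: V] (fun z => \sum_i sqcoord i z).
  by apply: measurable_sum => i; exact: measurable_sqcoord.
rewrite -[X in measurable X]setTI.
exact: (mf measurableT _ (measurable_set1 1)).
Qed.

Lemma sqcoord_ge0 i z : 0 <= sqcoord i z.
Proof. by rewrite addr_ge0 // sqr_ge0. Qed.

Lemma sqcoord_le1 i z : S z -> sqcoord i z <= 1.
Proof.
rewrite unit_vectorsE /= => <-; rewrite (bigD1 i) //= lerDl.
by apply: sumr_ge0 => j _; exact: sqcoord_ge0.
Qed.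

Definition bounded_on_sphere (f : 'cV[C]_d -> R) : Prop :=
  exists K, forall z, S z -> `|f z| <= K.

(** Measurability is global, so that it survives composition with unitaries; bounds exist only on
    the sphere, where all integrals are taken. Unlike integrability, the class is closed under
    products. *)
Definition bmeas (f : 'cV[C]_d -> R) : Prop :=
  measurable_fun [set: V] f /\ bounded_on_sphere f.

Lemma bmeas_cst c : bmeas (fun=> c).
Proof. by split; [exact: measurable_cst|exists `|c|]. Qed.

Lemma bmeasD f g : bmeas f -> bmeas g -> bmeas (fun z => f z + g z).
Proof.
move=> [mf [K Kf]] [mg [L Lg]]; split; first exact: measurable_funD.
by exists (K + L) => z Sz; rewrite (le_trans (ler_normD _ _)) // lerD ?Kf ?Lg.
Qed.

Lemma bmeasM f g : bmeas f -> bmeas g -> bmeas (fun z => f z * g z).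
Proof.
move=> [mf [K Kf]] [mg [L Lg]]; split; first exact: measurable_funM.
by exists (K * L) => z Sz; rewrite normrM ler_pM ?Kf ?Lg.
Qed.

Lemma bmeasZ c f : bmeas f -> bmeas (fun z => c * f z).
Proof. exact/bmeasM/bmeas_cst. Qed.

Lemma bmeasN f : bmeas f -> bmeas (fun z => - f z).
Proof.
move=> [mf [K Kf]]; split; first exact: measurable_funN.
by exists K => z Sz; rewrite normrN Kf.
Qed.

Lemma bmeasB f g : bmeas f -> bmeas g -> bmeas (fun z => f z - g z).
Proof. by move=> bf bg; apply: bmeasD => //; exact: bmeasN. Qed.

Lemma bmeasX f n : bmeas f -> bmeas (fun z => f z ^+ n).
Proof.
move=> bf; elim: n => [|n IH].
  by under eq_fun do rewrite expr0; exact: bmeas_cst.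
by under eq_fun do rewrite exprS; exact: bmeasM.
Qed.

Lemma bmeas_norm f : bmeas f -> bmeas (fun z => `|f z|).
Proof.
move=> [mf [K Kf]]; split; first exact: measurableT_comp.
by exists K => z Sz; rewrite normr_id Kf.
Qed.

Lemma bmeas_sum (I : Type) (s : seq I) (P : pred I) (F : I -> 'cV[C]_d -> R) :
  (forall i, bmeas (F i)) -> bmeas (fun z => \sum_(i <- s | P i) F i z).
Proof.
move=> bF; elim: s => [|i s IH].
  by under eq_fun do rewrite big_nil; exact: bmeas_cst.
under eq_fun do rewrite big_cons; case: (P i) => //; exact: bmeasD.
Qed.

Lemma bmeas_rcoord i : bmeas (rcoord i).
Proof.
split; first exact: measurable_rcoord.
exists 1 => z Sz; rewrite -(@ler_pXn2r _ 2) ?nnegrE // expr1n.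
rewrite -normrX ger0_norm ?sqr_ge0 //.
by apply: le_trans (sqcoord_le1 i Sz); rewrite lerDl sqr_ge0.
Qed.

Lemma bmeas_icoord i : bmeas (icoord i).
Proof.
split; first exact: measurable_icoord.
exists 1 => z Sz; rewrite -(@ler_pXn2r _ 2) ?nnegrE // expr1n.
rewrite -normrX ger0_norm ?sqr_ge0 //.
by apply: le_trans (sqcoord_le1 i Sz); rewrite lerDr sqr_ge0.
Qed.

Lemma bmeas_sqcoord i : bmeas (sqcoord i).
Proof.
by apply: bmeasD; apply: bmeasX; [exact: bmeas_rcoord|exact: bmeas_icoord].
Qed.

Variable mu : probability V R.

Definition sphere_mean (f : 'cV[C]_d -> R) : R := \int[mu]_(z in S) f z.

Local Notation E := sphere_mean.

Lemma bmeas_integrable f : bmeas f -> mu.-integrable S (EFin \o f).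
Proof.
move=> [mf [K Kf]]; apply: measurable_bounded_integrable.
- exact: measurable_unit_vectors.
- by apply: le_lt_trans (probability_le1 mu measurable_unit_vectors) _; rewrite ltry.
- exact: measurable_funS mf.
- exists K; split; first exact: num_real.
  by move=> x Kx z Sz; apply: le_trans (ltW Kx); exact: Kf.
Qed.

Lemma eq_mean f g : (forall z, S z -> f z = g z) -> E f = E g.
Proof. by move=> fg; apply: eq_Rintegral => z /set_mem /fg. Qed.

Lemma meanD f g : bmeas f -> bmeas g -> E (fun z => f z + g z) = E f + E g.
Proof.
move=> bf bg; apply: RintegralD; first exact: measurable_unit_vectors.
- exact: bmeas_integrable.
- exact: bmeas_integrable.
Qed.

Lemma meanZ c f : bmeas f -> E (fun z => c * f z) = c * E f.
Proof.
move=> bf; apply: RintegralZl; first exact: measurable_unit_vectors.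
exact: bmeas_integrable.
Qed.

Lemma meanB f g : bmeas f -> bmeas g -> E (fun z => f z - g z) = E f - E g.
Proof.
move=> bf bg; rewrite meanD //; last exact: bmeasN.
congr (_ + _).
rewrite -mulN1r -meanZ //; apply: eq_mean => z _; by rewrite mulN1r.
Qed.

Lemma mean_sum (I : Type) (s : seq I) (F : I -> 'cV[C]_d -> R) :
  (forall i, bmeas (F i)) ->
  E (fun z => \sum_(i <- s) F i z) = \sum_(i <- s) E (F i).
Proof.
move=> bF; elim: s => [|i s IH].
  rewrite big_nil; under eq_mean => z _ do rewrite big_nil.
  by rewrite /E Rintegral_cst ?mul0r //; exact: measurable_unit_vectors.
rewrite big_cons -IH -meanD //; last exact: bmeas_sum.
by apply: eq_mean => z _; rewrite big_cons.
Qed.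

Lemma le_mean f g : bmeas f -> bmeas g -> (forall z, S z -> f z <= g z) ->
  E f <= E g.
Proof.
move=> bf bg fg; apply: le_Rintegral => //; first exact: measurable_unit_vectors.
- exact: bmeas_integrable.
- exact: bmeas_integrable.
Qed.

Lemma mean_ge0 f : (forall z, S z -> 0 <= f z) -> 0 <= E f.
Proof. exact: Rintegral_ge0. Qed.

Hypothesis iso : isotropic mu.

Lemma mean_cst c : E (fun=> c) = c.
Proof.
rewrite /E Rintegral_cst; last exact: measurable_unit_vectors.
by rewrite [fine _](congr1 fine (proj1 iso)) mulr1.
Qed.

(** In dimension 0 the sphere is empty and cannot carry mass 1. *)
Lemma isotropic_dim_gt0 : (0 < d)%N.
Proof.
rewrite lt0n; apply/eqP => d0.
have S0 : S = set0.
  apply/seteqP; split => z //; rewrite unit_vectorsE /= big1 => [/eqP|i _].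
    by rewrite eq_sym oner_eq0.
  by have := ltn_ord i; rewrite [X in (_ < X)%N]d0.
have : mu S = 1%E := proj1 iso.
by rewrite S0 measure0 => /eqP; rewrite eq_sym onee_eq0.
Qed.

Lemma measurable_mulmx (U : 'M[C]_d) :
  measurable_fun [set: V] ((fun z => U *m z) : V -> V).
Proof.
have mr i : measurable_fun [set: V] (fun z => rcoord i (U *m z)).
  rewrite (_ : (fun _ => _) = fun z => \sum_j
     (complex.Re (U i j) * rcoord j z - complex.Im (U i j) * icoord j z)).
    apply: measurable_sum => j; apply: measurable_funB; apply: measurable_funM => //.
    - exact: measurable_rcoord.
    - exact: measurable_icoord.
  apply/funext => z; rewrite /rcoord mxE raddf_sum; apply: eq_bigr => j _.
  by rewrite /icoord; case: (U i j) => a b; case: (z j 0).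
have mi i : measurable_fun [set: V] (fun z => icoord i (U *m z)).
  rewrite (_ : (fun _ => _) = fun z => \sum_j
     (complex.Re (U i j) * icoord j z + complex.Im (U i j) * rcoord j z)).
    apply: measurable_sum => j; apply: measurable_funD; apply: measurable_funM => //.
    - exact: measurable_icoord.
    - exact: measurable_rcoord.
  apply/funext => z; rewrite /icoord mxE raddf_sum; apply: eq_bigr => j _.
  by rewrite /rcoord; case: (U i j) => a b; case: (z j 0).
apply: (@measurability _ _ V V setT _ (@coord_sets R d)) => //.
move=> _ [_ [i _ [B mB <-]] <-].
rewrite !setTI; have := measurable_fun_pair (mr i) (mi i).
by move=> /(_ measurableT _ mB); rewrite setTI.
Qed.

Lemma unit_vectors_mulmx (U : 'M[C]_d) z : U \is unitarymx ->
  S (U *m z) <-> S z.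
Proof.
move=> Uu; rewrite /unit_vectors /=.
by rewrite trmx_mul map_mxM mulmxA mulmxKtV.
Qed.

Lemma bmeas_mulmx U f : U \is unitarymx -> bmeas f ->
  bmeas (fun z => f (U *m z)).
Proof.
move=> Uu [mf [K Kf]]; split.
  by apply: (measurableT_comp mf (measurable_mulmx U)).
by exists K => z Sz; apply: Kf; apply/unit_vectors_mulmx.
Qed.

(** Change of variables: the image measure of [mu] under [U] is [mu], and the sphere is its own
    preimage. *)
Lemma mean_unitary U f : U \is unitarymx -> bmeas f ->
  E (fun z => f (U *m z)) = E f.
Proof.
move=> Uu bf; rewrite /E /Rintegral; congr fine.
pose phi : V -> V := fun z => U *m z.
have SE : phi @^-1` S = S.
  by apply/seteqP; split => z /=; rewrite unit_vectors_mulmx.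
have mphi : measurable_fun [set: V] phi by exact: measurable_mulmx.
rewrite -[LHS]/(\int[mu]_(z in S) ((EFin \o f) \o phi) z)%E -{1}SE.
rewrite -(integral_pushforward mphi).
- apply: eq_measure_integral => A mA _.
  by rewrite /pushforward -[RHS](proj2 iso U A Uu mA).
- by apply: measurableT_comp => //; case: bf.
- by rewrite SE; exact: (bmeas_integrable (bmeas_mulmx Uu bf)).
- exact: measurable_unit_vectors.
Qed.

End SphereMean.

(** * Unitary rotations of two coordinates *)

Lemma conjC_conjc (R : rcfType) (z : R[i]) : Num.conj z = conjc z.
Proof. by []. Qed.

(** Here [e + 1] and [s] are a cosine and a sine. The matrix is [1 + N1 + N2] with [N1] Hermitian
    and [N2] anti-Hermitian; they commute, and their squares are [e^2 D] and [-s^2 D], with [D] the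
    projector on the coordinate plane. The product with the adjoint is
    [1 + ((e + 1)^2 + s^2 - 1) D]. *)
Lemma generic_rot_unitary (C : numClosedFieldType) d (i j : 'I_d) (e s u : C) :
  i != j -> Num.conj e = e -> Num.conj s = s -> u * Num.conj u = 1 ->
  (e + 1) ^+ 2 + s ^+ 2 = 1 ->
  1%:M + e *: (delta_mx i i + delta_mx j j)
    + s *: (u *: delta_mx i j - Num.conj u *: delta_mx j i) \is unitarymx.
Proof.
move=> neq_ij eE sE uE es1.
have ji : (j == i) = false by rewrite eq_sym (negbTE neq_ij).
have ij := negbTE neq_ij.
have uE' : Num.conj u * u = 1 by rewrite mulrC.
apply/unitarymxP.
set N1 := e *: _; set N2 := s *: _.
have N1E : N1^t* = N1.
  apply/matrixP => k l; rewrite !mxE rmorphM rmorphD /= !conjC_nat eE.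
  by rewrite !(andbC (l == _)).
have N2E : N2^t* = - N2.
  apply/matrixP => k l; rewrite !mxE rmorphM rmorphB /= !rmorphM /= !conjC_nat.
  by rewrite conjCK sE !(andbC (l == _)); ring.
have -> : (1%:M + N1 + N2)^t* = 1%:M + N1 - N2.
  by rewrite !linearD/= !map_mxD/= N1E N2E trmx1 map_scalar_mx rmorph1.
have -> : (1%:M + N1 + N2) *m (1%:M + N1 - N2) =
  1%:M + (N1 + N1 + N1 *m N1) - N2 *m N2 + (N2 *m N1 - N1 *m N2).
  rewrite !(mulmxDl, mulmxDr, mulmxN, mul1mx, mulmx1).
  by apply/matrixP => k l; rewrite !mxE; ring.
set D := delta_mx i i + delta_mx j j : 'M[C]_d.
have N11 : N1 *m N1 = (e ^+ 2) *: D.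
  rewrite /N1 -scalemxAl -scalemxAr scalerA -expr2; congr (_ *: _).
  rewrite /D !(mulmxDl, mulmxDr) !mul_delta_mx_cond !eqxx ij ji.
  by rewrite !mulr1n !mulr0n addr0 add0r.
have N21 : N2 *m N1 = N1 *m N2.
  rewrite /N1 /N2 -!(scalemxAl, scalemxAr) !scalerA mulrC; congr (_ *: _).
  rewrite !(mulmxDl, mulmxDr, mulmxN, mulNmx) -!(scalemxAl, scalemxAr).
  rewrite !mul_delta_mx_cond !eqxx ij ji !mulr1n !mulr0n.
  by rewrite !(scaler0, addr0, add0r, oppr0) addrC.
have N22 : N2 *m N2 = (- s ^+ 2) *: D.
  rewrite /N2 -!(scalemxAl, scalemxAr) !scalerA.
  rewrite !(mulmxDl, mulmxDr, mulmxN, mulNmx) -!(scalemxAl, scalemxAr).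
  rewrite !mul_delta_mx_cond !eqxx ij ji !mulr1n !mulr0n.
  rewrite !(scaler0, addr0, add0r, oppr0, sub0r, subr0) !scalerA uE uE' !scale1r.
  by apply/matrixP => k l; rewrite !mxE; ring.
rewrite N21 subrr addr0 N11 N22 {1 2}/N1 -/D -!scalerDl -addrA -scalerBl.
rewrite (_ : _ - _ = 0) ?scale0r ?addr0 //.
by transitivity ((e + 1) ^+ 2 + s ^+ 2 - 1); [ring|rewrite es1 subrr].
Qed.

Section PlaneRotation.
Variables (R : realType) (d : nat) (i j : 'I_d).
Hypothesis neq_ij : i != j.
Variable a b : R.
Hypothesis ab1 : a ^+ 2 + b ^+ 2 = 1.
Local Notation C := R[i].
Local Notation S := (unit_vectors R d).

(* With [u = a + ib] of modulus one, this is the rotation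
   [z_i -> (z_i + t u z_j) / c], [z_j -> (z_j - t u^* z_i) / c],
   [c = sqrt (1 + t ^ 2)]. *)
Definition plane_rot (t : R) : 'M[C]_d :=
  let c := (Num.sqrt (1 + t ^+ 2))^-1 in
  1%:M + (c - 1)%:C%C *: (delta_mx i i + delta_mx j j)
  + (c * t)%:C%C *: ((a +i* b)%C *: delta_mx i j - (a -i* b)%C *: delta_mx j i).

Lemma plane_rot_factor (t : R) :
  let c := (Num.sqrt (1 + t ^+ 2))^-1 in c ^+ 2 = (1 + t ^+ 2)^-1.
Proof. by rewrite /= exprVn sqr_sqrtr // addr_ge0 ?sqr_ge0. Qed.

Lemma plane_rot_unitary t : plane_rot t \is unitarymx.
Proof.
have cE := plane_rot_factor t; rewrite /plane_rot /=; move: cE => /=.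
set c := (Num.sqrt _)^-1 => cE.
have cE' : c ^+ 2 * (1 + t ^+ 2) = 1.
  by rewrite cE mulVf // gt_eqF // ltr_pwDl // sqr_ge0.
have rE (r : R) : Num.conj r%:C%C = r%:C%C by rewrite conjC_conjc /= oppr0.
have uE : Num.conj (a +i* b)%C = (a -i* b)%C by [].
rewrite -uE; apply: generic_rot_unitary; rewrite ?rE //.
  rewrite uE /GRing.mul /=; apply/eqP; rewrite eq_complex /= -ab1.
  by apply/andP; split; apply/eqP; ring.
rewrite rmorphB rmorph1 subrK -!rmorphXn -rmorphD exprMn -{1}(mulr1 (c ^+ 2)).
by rewrite -mulrDr cE' rmorph1.
Qed.

Lemma plane_rotE t (z : 'cV[C]_d) k :
  let c := (Num.sqrt (1 + t ^+ 2))^-1 in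
  (plane_rot t *m z) k 0 = z k 0
    + (c - 1)%:C%C * ((k == i)%:R * z i 0 + (k == j)%:R * z j 0)
    + (c * t)%:C%C * ((a +i* b)%C * ((k == i)%:R * z j 0)
                      - (a -i* b)%C * ((k == j)%:R * z i 0)).
Proof.
have dE (k' l : 'I_d) : (delta_mx k' l *m z) k 0 = (k == k')%:R * z l 0.
  rewrite mxE (bigD1 l) //= mxE eqxx andbT big1 ?addr0 // => l' ne.
  by rewrite mxE (negbTE ne) andbF mul0r.
rewrite /plane_rot /= !(mulmxDl, mulNmx, mul1mx) -!scalemxAl.
rewrite !(mulmxDl, mulNmx) -!scalemxAl mxE [X in X + _]mxE.
by congr (_ + _ + _); rewrite !mxE -!dE !mxE.
Qed.

Local Notation x := (@rcoord R d).
Local Notation y := (@icoord R d).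
Local Notation p := (@sqcoord R d).

(* [Re (z_i^* u z_j)], half the derivative of [|z_i|^2] along the rotation. *)
Definition plane_cross (z : 'cV[C]_d) : R :=
  x i z * (a * x j z - b * y j z) + y i z * (a * y j z + b * x j z).

Lemma plane_rot_coord t (z : 'cV[C]_d) :
  let c := (Num.sqrt (1 + t ^+ 2))^-1 in
  [/\ x i (plane_rot t *m z) = c * (x i z + t * (a * x j z - b * y j z)),
      y i (plane_rot t *m z) = c * (y i z + t * (a * y j z + b * x j z)),
      x j (plane_rot t *m z) = c * (x j z - t * (a * x i z + b * y i z)) &
      y j (plane_rot t *m z) = c * (y j z - t * (a * y i z - b * x i z))].
Proof.
have ji : (j == i) = false by rewrite eq_sym (negbTE neq_ij).
have ij := negbTE neq_ij.
move=> c; rewrite /rcoord /icoord !plane_rotE -/c !eqxx ij ji !mul1r !mul0r.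
case: (z i 0) => xi yi; case: (z j 0) => xj yj /=.
by rewrite !(addr0, add0r, subr0, sub0r, mulr0, mul0r) /=; split; ring.
Qed.

(** With [t = tan theta], this and [plane_cross_plane_rot] say that the pair
    [(p i - p j, 2 plane_cross)] turns by the angle [2 theta]. Being exact and rational in [t], the
    formulas give derivative and remainder together. *)
Lemma sqcoord_plane_rot t (z : 'cV[C]_d) k :
  p k (plane_rot t *m z) = p k z +
    (2 * t * plane_cross z + t ^+ 2 * (p j z - p i z)) * ((k == i)%:R - (k == j)%:R)
      / (1 + t ^+ 2).
Proof.
have ji : (j == i) = false by rewrite eq_sym (negbTE neq_ij).
have ij := negbTE neq_ij.
have [xi yi xj yj] := plane_rot_coord t z.
move: xi yi xj yj (plane_rot_factor t) (mulVf (lt0r_neq0 (ltr_pwDl ltr01 (sqr_ge0 t)))).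
set c := (Num.sqrt _)^-1; set q := (1 + t ^+ 2)^-1 => xi yi xj yj /= cE qE.
(* [tq] and [b2] encode [q = 1 / (1 + t^2)] and [|u| = 1], the relations modulo which [ring] settles
   [k = i] and [k = j]. *)
have tq : t ^+ 2 * q = 1 - q by rewrite -qE mulrDr mulr1 addrC addKr mulrC.
have b2 : b ^+ 2 = 1 - a ^+ 2 by rewrite -ab1 addrAC subrr add0r.
have [->|ki] := eqVneq k i.
  by rewrite ij subr0 mulr1 /sqcoord xi yi !exprMn cE /plane_cross; ring: tq b2.
have [->|kj] := eqVneq k j.
  by rewrite sub0r mulrN1 /sqcoord xj yj !exprMn cE /plane_cross; ring: tq b2.
rewrite subrr mulr0 mul0r addr0 /sqcoord /rcoord /icoord plane_rotE.
by rewrite (negbTE ki) (negbTE kj) !(mul0r, mulr0, addr0, subr0).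
Qed.

Lemma plane_cross_plane_rot t (z : 'cV[C]_d) :
  plane_cross (plane_rot t *m z) =
    ((1 - t ^+ 2) * plane_cross z + t * (p j z - p i z)) / (1 + t ^+ 2).
Proof.
have [xi yi xj yj] := plane_rot_coord t z.
rewrite [in LHS]/plane_cross xi yi xj yj -plane_rot_factor /plane_cross /sqcoord.
set c := (Num.sqrt _)^-1.
have b2 : b ^+ 2 = 1 - a ^+ 2 by rewrite -ab1 addrAC subrr add0r.
ring: b2.
Qed.

End PlaneRotation.

(** * Moments of diagonal forms *)

Section Jet.
Variables (R : realType) (d : nat).
Local Notation C := R[i].
Local Notation S := (unit_vectors R d).
Variables (mu : probability (cspace R d) R) (U : R -> 'M[C]_d).
Hypotheses (iso : isotropic mu) (Uu : forall t, U t \is unitarymx).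

(* First-order expansion at [t = 0] along [U], uniform on the sphere and with a
   quadratic remainder, so that no derivative has to be exchanged with the
   integral. *)
Definition jet (f f1 : 'cV[C]_d -> R) : Prop :=
  [/\ bmeas f, bmeas f1 & exists K, forall t z, 0 < t -> t <= 1 -> S z ->
    `|f (U t *m z) - f z - t * f1 z| <= K * t ^+ 2].

Lemma jet_ext f f1 g1 : (forall z, f1 z = g1 z) -> jet f f1 -> jet f g1.
Proof. by move=> /funext ->. Qed.

Lemma jet_cst c : jet (fun=> c) (fun=> 0).
Proof.
split; [exact: bmeas_cst|exact: bmeas_cst|exists 0 => t z _ _ _].
by rewrite subrr mulr0 subrr normr0 mul0r.
Qed.

Lemma jetD f f1 g g1 : jet f f1 -> jet g g1 ->
  jet (fun z => f z + g z) (fun z => f1 z + g1 z).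
Proof.
move=> [bf bf1 [K Kf]] [bg bg1 [L Lg]]; split; [exact: bmeasD|exact: bmeasD|].
exists (K + L) => t z t0 t1 Sz; rewrite mulrDl.
apply: le_trans (lerD (Kf t z t0 t1 Sz) (Lg t z t0 t1 Sz)).
apply: le_trans (ler_normD _ _); rewrite le_eqVlt; apply/orP; left.
by apply/eqP; congr `|_|; ring.
Qed.

Lemma jetM f f1 g g1 : jet f f1 -> jet g g1 ->
  jet (fun z => f z * g z) (fun z => f z * g1 z + f1 z * g z).
Proof.
move=> [bf bf1 [K Kf]] [bg bg1 [L Lg]].
split; [exact: bmeasM|by apply: bmeasD; exact: bmeasM|].
have [_ [F BF]] := bf; have [_ [F1 BF1]] := bf1.
have [_ [G BG]] := bg; have [_ [G1 BG1]] := bg1.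
exists (K * G + (F + F1) * L + F1 * G1) => t z t0 t1 Sz.
have Uz : S (U t *m z) by apply/unit_vectors_mulmx.
(* Three pieces: the remainder of [f] against the rotated [g], the expansion of [f] against the
   remainder of [g], and the second-order cross term. They give the three summands of the
   constant. *)
rewrite (_ : _ - _ = (f (U t *m z) - f z - t * f1 z) * g (U t *m z) +
   (f z + t * f1 z) * (g (U t *m z) - g z - t * g1 z) + t ^+ 2 * (f1 z * g1 z));
  last by ring.
have -> : (K * G + (F + F1) * L + F1 * G1) * t ^+ 2 =
  K * t ^+ 2 * G + (F + F1) * (L * t ^+ 2) + t ^+ 2 * (F1 * G1) by ring.
apply: le_trans (ler_normD _ _) _; apply: lerD.
  apply: le_trans (ler_normD _ _) _; apply: lerD.
    by rewrite normrM; apply: ler_pM; rewrite ?Kf ?BG.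
  rewrite normrM; apply: ler_pM; rewrite ?Lg //.
  apply: le_trans (ler_normD _ _) _; rewrite lerD ?BF // normrM.
  by apply: le_trans (BF1 z Sz); rewrite ler_piMl // ger0_norm // ltW.
rewrite normrM (ger0_norm (sqr_ge0 t)) ler_wpM2l ?sqr_ge0 // normrM.
by apply: ler_pM; rewrite ?BF1 ?BG1.
Qed.

Lemma jetZ c f f1 : jet f f1 -> jet (fun z => c * f z) (fun z => c * f1 z).
Proof.
move=> jf; apply: jet_ext (jetM (jet_cst c) jf) => z.
by rewrite mul0r addr0.
Qed.

Lemma jetX f f1 n : jet f f1 ->
  jet (fun z => f z ^+ n) (fun z => n%:R * f z ^+ n.-1 * f1 z).
Proof.
move=> jf; elim: n => [|n IH].
  under eq_fun do rewrite expr0.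
  by apply: jet_ext (jet_cst 1) => z; rewrite !mul0r.
under eq_fun do rewrite exprS.
apply: jet_ext (jetM jf IH) => z.
(* At [n = 0] the exponent [n.-1] is 0 too, and only the factor [n%:R] removes that term. *)
case: n {IH} => [|n] /=; first by rewrite !expr0; ring.
by rewrite exprS; ring.
Qed.

Lemma jet_sum (I : Type) (s : seq I) (f f1 : I -> 'cV[C]_d -> R) :
  (forall i, jet (f i) (f1 i)) ->
  jet (fun z => \sum_(i <- s) f i z) (fun z => \sum_(i <- s) f1 i z).
Proof.
move=> jf; elim: s => [|i s IH].
  under eq_fun do rewrite big_nil.
  by under [X in jet _ X]eq_fun do rewrite big_nil; exact: jet_cst.
under eq_fun do rewrite big_cons.
by under [X in jet _ X]eq_fun do rewrite big_cons; exact: jetD.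
Qed.

(** Both rotation formulas have this shape. As [1 + t^2 >= 1] and [t <= 1], the bounds of [g] and
    [h] add up to a uniform constant. *)
Lemma jet_of_remainder f f1 g h : bmeas f -> bmeas f1 -> bmeas g -> bmeas h ->
  (forall t z, f (U t *m z) =
     f z + t * f1 z + t ^+ 2 * ((g z + t * h z) / (1 + t ^+ 2))) ->
  jet f f1.
Proof.
move=> bf bf1 [_ [G BG]] [_ [H BH]] fE; split=> //.
exists (G + H) => t z t0 t1 Sz.
rewrite fE (_ : _ - _ = (g z + t * h z) / (1 + t ^+ 2) * t ^+ 2); last by ring.
rewrite normrM (ger0_norm (sqr_ge0 t)) ler_wpM2r ?sqr_ge0 //.
have q0 : 0 < 1 + t ^+ 2 by rewrite ltr_pwDl // sqr_ge0.
rewrite normrM normfV (gtr0_norm q0) ler_pdivrMr //.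
have GH : `|g z + t * h z| <= G + H.
  apply: le_trans (ler_normD _ _) _; rewrite lerD ?BG // normrM.
  by apply: le_trans (BH z Sz); rewrite ler_piMl // ger0_norm // ltW.
apply: (le_trans GH); rewrite ler_peMr ?lerDl ?sqr_ge0 //.
exact: le_trans GH.
Qed.

(** Invariance cancels the means of [f] and of its rotation, so [t |E f1| <= K t^2]; divide by [t]
    and let [t] tend to 0. *)
Lemma mean_jet f f1 : jet f f1 -> sphere_mean mu f1 = 0.
Proof.
move=> [bf bf1 [K Kf]]; apply/eqP; rewrite -normr_le0; apply/ler_addgt0Pl => e e0.
rewrite addr0; set E := sphere_mean mu f1.
have K0 : 0 <= Num.max K 0 by rewrite le_max lexx orbT.
(* No sign of [K] is known, hence the maximum; this [t] brings the error [t K] below [e]. *)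
pose t := Num.min 1 (e / (Num.max K 0 + 1)).
have K1 : 0 < Num.max K 0 + 1 by rewrite ltr_wpDl.
have t0 : 0 < t by rewrite lt_min ltr01 divr_gt0.
have t1 : t <= 1 by rewrite ge_min lexx.
have te : t * (Num.max K 0 + 1) <= e by rewrite -ler_pdivlMr // ge_min lexx orbT.
have bfU := bmeas_mulmx (Uu t) bf.
have bd z : S z -> `|f (U t *m z) - f z - t * f1 z| <= Num.max K 0 * t ^+ 2.
  move=> Sz; apply: le_trans (Kf t z t0 t1 Sz) _.
  by rewrite ler_wpM2r ?sqr_ge0 // le_max lexx.
have bd1 : bmeas (fun z => f (U t *m z) - f z - t * f1 z).
  by apply: bmeasB; [exact: bmeasB|exact: bmeasZ].
have tE : sphere_mean mu (fun z => f (U t *m z) - f z - t * f1 z) = - (t * E).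
  rewrite meanB ?meanB ?mean_unitary ?meanZ ?subrr ?sub0r //.
  - exact: bmeasB.
  - exact: bmeasZ.
have up := le_mean mu bd1 (bmeas_cst _ (Num.max K 0 * t ^+ 2))
  (fun z Sz => le_trans (ler_norm _) (bd z Sz)).
have lo := le_mean mu (bmeas_cst _ (- (Num.max K 0 * t ^+ 2))) bd1
  (fun z Sz => lerNnormlW (bd z Sz)).
move: up lo; rewrite tE !mean_cst // lerN2 => up lo.
have : t * `|E| <= Num.max K 0 * t ^+ 2.
  by rewrite -[X in X * _](gtr0_norm t0) -normrM ler_norml lerNl up lo.
rewrite expr2 mulrCA ler_pM2l // => EK; apply: (le_trans EK).
by apply: le_trans te; rewrite mulrC ler_pM2l // lerDl.
Qed.

End Jet.

(** * Moment recursion from invariance under plane rotations *)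

Section DiagonalRecursion.
Variables (R : realType) (d : nat).
Local Notation C := R[i].
Local Notation S := (unit_vectors R d).
Variable mu : probability (cspace R d) R.
Hypothesis iso : isotropic mu.
Local Notation E := (sphere_mean mu).
Local Notation p := (@sqcoord R d).
Variable m : 'I_d -> R.

Definition diag_form (z : 'cV[C]_d) : R := \sum_k m k * p k z.
Local Notation X := diag_form.

Lemma bmeas_diag_form : bmeas X.
Proof. by apply: bmeas_sum => k; apply: bmeasZ; exact: bmeas_sqcoord. Qed.

Lemma bmeas_plane_cross (i j : 'I_d) (a b : R) : bmeas (plane_cross i j a b).
Proof.
apply: bmeasD; apply: bmeasM; try exact: bmeas_rcoord; try exact: bmeas_icoord.
- by apply: bmeasB; apply: bmeasZ; [exact: bmeas_rcoord|exact: bmeas_icoord].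
- by apply: bmeasD; apply: bmeasZ; [exact: bmeas_icoord|exact: bmeas_rcoord].
Qed.

(** The derivative of [plane_cross * X^n] along the rotation has mean zero: [plane_cross]
    contributes [p j - p i], and [X] contributes [2 (m i - m j) plane_cross]. *)
Lemma mean_rotation (i j : 'I_d) (a b : R) n : i != j -> a ^+ 2 + b ^+ 2 = 1 ->
  E (fun z => (p i z - p j z) * X z ^+ n) =
  2 * n%:R * (m i - m j) * E (fun z => plane_cross i j a b z ^+ 2 * X z ^+ n.-1).
Proof.
move=> ij ab1; pose U := plane_rot i j a b.
have Uu t : U t \is unitarymx by exact: plane_rot_unitary.
set r := plane_cross i j a b.
have br : bmeas r by exact: bmeas_plane_cross.
have bpj : bmeas (fun z => p j z - p i z) by apply: bmeasB; exact: bmeas_sqcoord.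
have bX := bmeas_diag_form.
have q0 t : 1 + t ^+ 2 != 0 :> R by rewrite gt_eqF // ltr_pwDl // sqr_ge0.
have jp k : jet U (p k) (fun z => 2 * r z * ((k == i)%:R - (k == j)%:R)).
  (* The witnesses [g] and [h], here and for [jr], come from
     [1 / (1 + t^2) = 1 - t^2 / (1 + t^2)]. *)
  set s := (_ - _); apply: (jet_of_remainder
    (g := fun z => s * (p j z - p i z)) (h := fun z => s * (- 2 * r z))).
  - exact: bmeas_sqcoord.
  - apply: bmeasM; [exact: bmeasZ|exact: bmeas_cst].
  - exact: bmeasZ.
  - by apply: bmeasZ; exact: bmeasZ.
  by move=> t z; rewrite sqcoord_plane_rot // -/s -/r; field.
have jr : jet U r (fun z => p j z - p i z).
  apply: (jet_of_remainder
    (g := fun z => - 2 * r z) (h := fun z => - 1 * (p j z - p i z))) => //.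
  - exact: bmeasZ.
  - exact: bmeasZ.
  by move=> t z; rewrite /r plane_cross_plane_rot // -/r; field.
have jX : jet U X (fun z => 2 * (m i - m j) * r z).
  apply: jet_ext (jet_sum _ (fun k => jetZ Uu (m k) (jp k))) => z.
  have ji : j != i by rewrite eq_sym.
  rewrite (bigD1 i) //= (bigD1 j) //= big1 => [|k /andP[ki kj]].
    by rewrite !eqxx (negbTE ij) (negbTE ji) mulr1n mulr0n; ring.
  by rewrite (negbTE ki) (negbTE kj) mulr0n; ring.
have := mean_jet iso Uu (jetM Uu jr (jetX Uu n jX)).
rewrite meanD; last 2 first.
- apply: bmeasM => //; apply: bmeasM; last exact: bmeasZ.
  by apply: bmeasZ; exact: bmeasX.
- by apply: bmeasM => //; exact: bmeasX.
move=> /eqP; rewrite addrC addr_eq0 => /eqP H.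
have -> : E (fun z => (p i z - p j z) * X z ^+ n) =
    -1 * E (fun z => (p j z - p i z) * X z ^+ n).
  rewrite -meanZ; last by apply: bmeasM => //; exact: bmeasX.
  by apply: eq_mean => z _; ring.
rewrite H mulrNN mul1r -meanZ; last by apply: bmeasM; exact: bmeasX.
by apply: eq_mean => z _; ring.
Qed.

(* The phases [u = 1] and [u = i] turn the square of [plane_cross] into
   [|z_i|^2 |z_j|^2] after summation. *)
Lemma mean_sqcoord_diff (i j : 'I_d) n :
  E (fun z => p i z * X z ^+ n) - E (fun z => p j z * X z ^+ n) =
  n%:R * (m i - m j) * E (fun z => p i z * p j z * X z ^+ n.-1).
Proof.
have [->|ij] := eqVneq i j; first by rewrite !subrr mulr0 mul0r.
have bp k : bmeas (p k) by exact: bmeas_sqcoord.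
have bXn k : bmeas (fun z => X z ^+ k) by apply: bmeasX; exact: bmeas_diag_form.
have br a b : bmeas (fun z => plane_cross i j a b z ^+ 2 * X z ^+ n.-1).
  by apply: bmeasM => //; apply: bmeasX; exact: bmeas_plane_cross.
rewrite -meanB; [|exact: bmeasM|exact: bmeasM].
under eq_mean => z _ do rewrite -mulrBl.
have H10 : 1 ^+ 2 + 0 ^+ 2 = 1 :> R by ring.
have H01 : 0 ^+ 2 + 1 ^+ 2 = 1 :> R by ring.
have e1 := mean_rotation n ij H10; have e2 := mean_rotation n ij H01.
have -> : E (fun z => p i z * p j z * X z ^+ n.-1) =
    E (fun z => plane_cross i j 1 0 z ^+ 2 * X z ^+ n.-1) +
    E (fun z => plane_cross i j 0 1 z ^+ 2 * X z ^+ n.-1).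
  rewrite -meanD //; apply: eq_mean => z _.
  by rewrite /plane_cross /sqcoord; ring.
set A := E _ in e1 e2 *; move: e1 e2.
by move: (E _) (E _) => B1 B2 e1 e2; lra.
Qed.

Lemma mean_sqcoord_rec (i : 'I_d) n :
  (d + n)%:R * E (fun z => p i z * X z ^+ n) =
  E (fun z => X z ^+ n) + n%:R * m i * E (fun z => p i z * X z ^+ n.-1).
Proof.
have bp k : bmeas (p k) by exact: bmeas_sqcoord.
have bXn k : bmeas (fun z => X z ^+ k) by apply: bmeasX; exact: bmeas_diag_form.
have XE : E (fun z => X z ^+ n) = \sum_j E (fun z => p j z * X z ^+ n).
  rewrite -mean_sum; last by move=> j; exact: bmeasM.
  apply: eq_mean => z; rewrite unit_vectorsE /= => pz.
  by rewrite -mulr_suml pz mul1r.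
(* The sum over [j] collapses on the sphere, where the [p j] add up to 1 and the [m j * p j] to [X].
   The case [n = 0] is apart because [n.-1] truncates; both sides then vanish. *)
have YE : n%:R * (m i * E (fun z => p i z * X z ^+ n.-1) -
    E (fun z => p i z * X z ^+ n)) =
    \sum_j n%:R * (m i - m j) * E (fun z => p i z * p j z * X z ^+ n.-1).
  case: n {XE} => [|n]; first by rewrite mul0r big1 // => j _; rewrite !mul0r.
  have -> : E (fun z => p i z * X z ^+ n.+1) =
      \sum_j m j * E (fun z => p i z * p j z * X z ^+ n).
    rewrite (_ : \sum_j _ = \sum_j E (fun z => m j * (p i z * p j z * X z ^+ n))).
      rewrite -mean_sum; last first.
        by move=> j; apply: bmeasZ; apply: bmeasM => //; exact: bmeasM.
      apply: eq_mean => z _; rewrite exprS {1}/diag_form mulr_suml mulr_sumr.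
      by apply: eq_bigr => j _; ring.
    by apply: eq_bigr => j _; rewrite meanZ //; apply: bmeasM => //; exact: bmeasM.
  have -> : E (fun z => p i z * X z ^+ n) =
      \sum_j E (fun z => p i z * p j z * X z ^+ n).
    rewrite -mean_sum; last by move=> j; apply: bmeasM => //; exact: bmeasM.
    apply: eq_mean => z; rewrite unit_vectorsE /= => pz.
    by rewrite -mulr_suml -mulr_sumr pz mulr1.
  rewrite mulr_sumr -sumrB mulr_sumr; apply: eq_bigr => j _; ring.
have SE : d%:R * E (fun z => p i z * X z ^+ n) - E (fun z => X z ^+ n) =
    n%:R * (m i * E (fun z => p i z * X z ^+ n.-1) - E (fun z => p i z * X z ^+ n)).
  rewrite YE XE (_ : d%:R * _ = \sum_(j < d) E (fun z => p i z * X z ^+ n)).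
    by rewrite -sumrB; apply: eq_bigr => j _; rewrite mean_sqcoord_diff.
  by rewrite sumr_const card_ord mulr_natl.
by rewrite natrD mulrDl; lra.
Qed.

End DiagonalRecursion.

(** * Moments of Hermitian forms *)

Section HermitianForm.
Variables (R : realType) (d : nat).
Local Notation C := R[i].

Definition sqmod (w : C) : R := complex.Re w ^+ 2 + complex.Im w ^+ 2.

Definition frob (A : 'M[C]_d) : R := \sum_k \sum_l sqmod (A k l).

Definition quad_form (M : 'M[C]_d) (z : 'cV[C]_d) : R :=
  complex.Re ((z^t* *m M *m z) 0 0).

(** For Hermitian [M] this is [W = (Tr M)^2 + Tr M^2]; written with entries it is visibly a sum of
    squares. *)
Definition quad_weight (M : 'M[C]_d) : R := complex.Re (\tr M) ^+ 2 + frob M.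

Lemma sqmod_ge0 w : 0 <= sqmod w.
Proof. by rewrite addr_ge0 ?sqr_ge0. Qed.

Lemma frob_ge0 A : 0 <= frob A.
Proof. by apply: sumr_ge0 => k _; apply: sumr_ge0 => l _; exact: sqmod_ge0. Qed.

Lemma quad_weight_ge0 M : 0 <= quad_weight M.
Proof. by rewrite addr_ge0 ?sqr_ge0 ?frob_ge0. Qed.

Lemma Re_conjM (w : C) : complex.Re (Num.conj w * w) = sqmod w.
Proof. by case: w => a b; rewrite /sqmod /=; ring. Qed.

Lemma Re_mxtrace_gram (A : 'M[C]_d) : complex.Re (\tr (A^t* *m A)) = frob A.
Proof.
rewrite raddf_sum /frob exchange_big; apply: eq_bigr => k _.
rewrite mxE raddf_sum; apply: eq_bigr => l _.
by rewrite !mxE; exact: Re_conjM.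
Qed.

Lemma hermsymmx_trC (M : 'M[C]_d) : M \is hermsymmx -> M^t* = M.
Proof. by move=> /is_hermitianmxP; rewrite expr0 scale1r => /esym. Qed.

Lemma quad_form_diag (M : 'M[C]_d) z : M \is hermsymmx ->
  quad_form M z = diag_form (fun k => complex.Re (spectral_diag M 0 k))
    (spectralmx M *m z).
Proof.
move=> Mh; have /orthomx_spectralP ME := hermitian_normalmx Mh.
have Pu := spectral_unitarymx M.
have sr k : spectral_diag M 0 k \is Num.real.
  by have /mxOverP := hermitian_spectral_diag_real Mh; apply.
rewrite /quad_form {1}ME invmx_unitary //.
set P := spectralmx M; set s := spectral_diag M.
rewrite -!mulmxA mulmxA -map_mxM -trmx_mul; move: (P *m z) => w.
rewrite mxE raddf_sum; apply: eq_bigr => k _; rewrite mul_diag_mx !mxE.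
have /complex_realP[r rE] := sr k.
rewrite [s 0 k]rE /sqcoord /rcoord /icoord.
by case: (w k 0) => a b /=; ring.
Qed.

Lemma mxtrace_spectral_diag (M : 'M[C]_d) : M \is hermsymmx ->
  complex.Re (\tr M) = \sum_k complex.Re (spectral_diag M 0 k).
Proof.
move=> Mh; have /orthomx_spectralP {1}-> := hermitian_normalmx Mh.
by rewrite mxtrace_mulC mulmxA mulmxV ?spectral_unit // mul1mx mxtrace_diag raddf_sum.
Qed.

Lemma frob_spectral_diag (M : 'M[C]_d) : M \is hermsymmx ->
  frob M = \sum_k complex.Re (spectral_diag M 0 k) ^+ 2.
Proof.
move=> Mh; rewrite -Re_mxtrace_gram hermsymmx_trC //.
have sr k : spectral_diag M 0 k \is Num.real.
  by have /mxOverP := hermitian_spectral_diag_real Mh; apply.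
have /orthomx_spectralP ME := hermitian_normalmx Mh.
rewrite {1 2}ME -!mulmxA mxtrace_mulC !mulmxA !mulmxK ?spectral_unit //.
rewrite mulmx_diag mxtrace_diag raddf_sum.
apply: eq_bigr => k _; rewrite mxE.
have /complex_realP[r ->] := sr k.
by rewrite /=; ring.
Qed.

End HermitianForm.

(** * Second and fourth moments of a diagonal form *)

Section DiagonalMoments.
Variables (R : realType) (d : nat).
Variable mu : probability (cspace R d) R.
Hypothesis iso : isotropic mu.
Local Notation E := (sphere_mean mu).
Local Notation p := (@sqcoord R d).
Variable m : 'I_d -> R.
Local Notation X := (diag_form m).
Local Notation P n := (\sum_(k < d) m k ^+ n).

Let D n : (d + n)%:R != 0 :> R.
Proof. by rewrite pnatr_eq0 -lt0n ltn_addr // (isotropic_dim_gt0 iso). Qed.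

Let dE : d%:R = (d + 0)%:R :> R.
Proof. by rewrite addn0. Qed.

Let meanXS n : E (fun z => X z ^+ n.+1) = \sum_k m k * E (fun z => p k z * X z ^+ n).
Proof.
have bXn : bmeas (fun z => X z ^+ n) by apply: bmeasX; exact: bmeas_diag_form.
have bp k : bmeas (p k) by exact: bmeas_sqcoord.
transitivity (\sum_k E (fun z => m k * (p k z * X z ^+ n))); last first.
  by apply: eq_bigr => k _; rewrite meanZ //; exact: bmeasM.
rewrite -mean_sum; last by move=> k; apply: bmeasZ; exact: bmeasM.
apply: eq_mean => z _; rewrite exprS {1}/diag_form mulr_suml.
by apply: eq_bigr => k _; rewrite mulrA.
Qed.

(** For [n <= 3] the mean of [p k * X^n] is a polynomial of degree at most 3 in [m k], so each next
    moment is read off in power sums. *)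
Let sum_cubic c0 c1 c2 c3 :
  \sum_k m k * (c0 + c1 * m k + c2 * m k ^+ 2 + c3 * m k ^+ 3) =
  c0 * P 1 + c1 * P 2 + c2 * P 3 + c3 * P 4.
Proof.
rewrite !mulr_sumr -!big_split /=; apply: eq_bigr => k _; ring.
Qed.

Let mean_sq k n : E (fun z => p k z * X z ^+ n) =
  (E (fun z => X z ^+ n) + n%:R * m k * E (fun z => p k z * X z ^+ n.-1)) / (d + n)%:R.
Proof. by rewrite -mean_sqcoord_rec // mulrC mulKf. Qed.

Let meanX0 : E (fun z => X z ^+ 0) = 1.
Proof. by under eq_mean => z _ do rewrite expr0; rewrite mean_cst. Qed.

Let mean_sq0 k : E (fun z => p k z * X z ^+ 0) = (d + 0)%:R^-1.
Proof. by rewrite mean_sq meanX0 mulr0n !mul0r addr0 mul1r. Qed.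

Let meanX1 : E (fun z => X z ^+ 1) = P 1 / (d + 0)%:R.
Proof.
rewrite meanXS mulr_suml; apply: eq_bigr => k _.
by rewrite mean_sq0.
Qed.

Let mean_sq1 k : E (fun z => p k z * X z ^+ 1) =
  (P 1 + m k) / ((d + 0)%:R * (d + 1)%:R).
Proof.
rewrite mean_sq meanX1 mean_sq0 mulr1n.
by move: (D 0) (D 1); move: (d + 0)%:R (d + 1)%:R => q0 q1 h0 h1; field; rewrite h0 h1.
Qed.

Lemma mean_diag_form_sqr :
  E (fun z => X z ^+ 2) = (P 1 ^+ 2 + P 2) / (d%:R * (d + 1)%:R).
Proof.
rewrite dE meanXS; set Q := (d + 0)%:R * (d + 1)%:R.
transitivity (\sum_k m k * (P 1 / Q + Q^-1 * m k + 0 * m k ^+ 2 + 0 * m k ^+ 3)).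
  by apply: eq_bigr => k _; rewrite mean_sq1 -/Q; ring.
by rewrite sum_cubic; ring.
Qed.

Let mean_sq2 k : E (fun z => p k z * X z ^+ 2) =
  (P 1 ^+ 2 + P 2 + 2 * m k * P 1 + 2 * m k ^+ 2) /
    ((d + 0)%:R * (d + 1)%:R * (d + 2)%:R).
Proof.
rewrite mean_sq mean_diag_form_sqr mean_sq1 dE.
move: (D 0) (D 1) (D 2); move: (d + 0)%:R (d + 1)%:R (d + 2)%:R => q0 q1 q2 h0 h1 h2.
by field; rewrite h0 h1 h2.
Qed.

Let meanX3 : E (fun z => X z ^+ 3) =
  (P 1 ^+ 3 + 3 * P 1 * P 2 + 2 * P 3) / ((d + 0)%:R * (d + 1)%:R * (d + 2)%:R).
Proof.
rewrite meanXS; set Q := (d + 0)%:R * (d + 1)%:R * (d + 2)%:R.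
transitivity (\sum_k m k * ((P 1 ^+ 2 + P 2) / Q + 2 * P 1 / Q * m k
   + 2 / Q * m k ^+ 2 + 0 * m k ^+ 3)).
  by apply: eq_bigr => k _; rewrite mean_sq2 -/Q; ring.
by rewrite sum_cubic; ring.
Qed.

(** The numerator is [4!] times the complete homogeneous symmetric polynomial of degree 4 in [m],
    expanded in power sums. *)
Lemma mean_diag_form_pow4 :
  E (fun z => X z ^+ 4) =
  (P 1 ^+ 4 + 6 * P 1 ^+ 2 * P 2 + 8 * P 1 * P 3 + 3 * P 2 ^+ 2 + 6 * P 4)
    / (d%:R * (d + 1)%:R * (d + 2)%:R * (d + 3)%:R).
Proof.
rewrite dE meanXS; set Q := (d + 0)%:R * (d + 1)%:R * (d + 2)%:R * (d + 3)%:R.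
transitivity (\sum_k m k * ((P 1 ^+ 3 + 3 * P 1 * P 2 + 2 * P 3) / Q
   + 3 * (P 1 ^+ 2 + P 2) / Q * m k + 6 * P 1 / Q * m k ^+ 2 + 6 / Q * m k ^+ 3)).
  apply: eq_bigr => k _; congr (_ * _).
  rewrite mean_sq meanX3 mean_sq2 /Q.
  move: (D 0) (D 1) (D 2) (D 3).
  move: (d + 0)%:R (d + 1)%:R (d + 2)%:R (d + 3)%:R => q0 q1 q2 q3 h0 h1 h2 h3.
  by field; rewrite h0 h1 h2 h3.
by rewrite sum_cubic; ring.
Qed.

(** With [P13] and then [P4], the numerator is at most [P1^4 + 14 P1^2 P2 + 11 P2^2]; the 11 is
    [3 + 8]. *)
Lemma mean_diag_form_pow4_le :
  E (fun z => X z ^+ 4) <= 11 * (P 1 ^+ 2 + P 2) ^+ 2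
    / (d%:R * (d + 1)%:R * (d + 2)%:R * (d + 3)%:R).
Proof.
rewrite mean_diag_form_pow4 ler_pM2r ?invr_gt0; last first.
  by rewrite !mulr_gt0 // ltr0n ?addn_gt0 ?orbT // (isotropic_dim_gt0 iso).
have P2 : 0 <= P 2 by apply: sumr_ge0 => k _; rewrite sqr_ge0.
have P4 : P 4 <= P 2 ^+ 2.
  rewrite expr2 mulr_suml; apply: ler_sum => k _.
  rewrite (exprD _ 2 2) ler_wpM2l ?sqr_ge0 // (bigD1 k) //= lerDl.
  by apply: sumr_ge0 => l _; rewrite sqr_ge0.
(* Termwise, the difference of the two sides is twice a square. *)
have P13 : 8 * P 1 * P 3 <= 8 * P 1 ^+ 2 * P 2 + 2 * P 4.
  move: (P 1) => q; rewrite !mulr_sumr -big_split; apply: ler_sum => k _ /=.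
  rewrite -subr_ge0 (_ : _ - _ = 2 * (2 * q * m k - m k ^+ 2) ^+ 2); last by ring.
  by rewrite mulr_ge0 // sqr_ge0.
have P1 : 0 <= P 1 ^+ 4 by rewrite (exprM _ 2 2) sqr_ge0.
have P12 : 0 <= P 1 ^+ 2 * P 2 by rewrite mulr_ge0 // sqr_ge0.
have -> : 11 * (P 1 ^+ 2 + P 2) ^+ 2 =
  11 * P 1 ^+ 4 + 22 * (P 1 ^+ 2 * P 2) + 11 * P 2 ^+ 2 by ring.
lra.
Qed.

End DiagonalMoments.

Section HermitianMoments.
Variables (R : realType) (d : nat).
Variable mu : probability (cspace R d) R.
Hypothesis iso : isotropic mu.
Local Notation E := (sphere_mean mu).
Variable M : 'M[R[i]]_d.
Hypothesis Mh : M \is hermsymmx.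

(** The diagonalising unitary is absorbed by the invariance of the measure. *)
Let mean_quad_form_diag n : E (fun z => quad_form M z ^+ n) =
  E (fun z => diag_form (fun k => complex.Re (spectral_diag M 0 k)) z ^+ n).
Proof.
set X := diag_form _.
have bX : bmeas (fun z => X z ^+ n) by apply: bmeasX; exact: bmeas_diag_form.
rewrite -(mean_unitary iso (spectral_unitarymx M) bX).
by apply: eq_mean => z _; rewrite quad_form_diag.
Qed.

Lemma mean_quad_form_sqr : E (fun z => quad_form M z ^+ 2) =
  quad_weight M / (d%:R * (d + 1)%:R).
Proof.
rewrite mean_quad_form_diag mean_diag_form_sqr // /quad_weight.
by rewrite frob_spectral_diag // mxtrace_spectral_diag.
Qed.

Lemma mean_quad_form_pow4_le : E (fun z => quad_form M z ^+ 4) <=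
  11 * quad_weight M ^+ 2 / (d%:R * (d + 1)%:R * (d + 2)%:R * (d + 3)%:R).
Proof.
rewrite mean_quad_form_diag; apply: le_trans (mean_diag_form_pow4_le iso _) _.
by rewrite /quad_weight frob_spectral_diag // mxtrace_spectral_diag.
Qed.

End HermitianMoments.

(** * Quadratic forms in coordinates; Hermitian and anti-Hermitian parts *)

Section QuadForm.
Variables (R : realType) (d : nat).
Local Notation C := R[i].
Local Notation x := (@rcoord R d).
Local Notation y := (@icoord R d).
Implicit Types (M : 'M[C]_d) (z : 'cV[C]_d).

Lemma quad_formE M z : quad_form M z = \sum_k \sum_l
  (complex.Re (M k l) * (x k z * x l z + y k z * y l z)
   - complex.Im (M k l) * (x k z * y l z - y k z * x l z)).
Proof.
rewrite /quad_form -mulmxA mxE raddf_sum; apply: eq_bigr => k _.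
rewrite [(M *m z) _ _]mxE mulr_sumr raddf_sum; apply: eq_bigr => l _.
rewrite !mxE /rcoord /icoord; case: (M k l) => a b.
by case: (z k 0) => xk yk; case: (z l 0) => xl yl /=; ring.
Qed.

Lemma bmeas_quad_form M : bmeas (quad_form M).
Proof.
rewrite (_ : quad_form M = fun z => \sum_k \sum_l
  (complex.Re (M k l) * (x k z * x l z + y k z * y l z)
   - complex.Im (M k l) * (x k z * y l z - y k z * x l z))); last first.
  by apply/funext => z; exact: quad_formE.
apply: bmeas_sum => k; apply: bmeas_sum => l.
have [bx by_] : (forall k, bmeas (x k)) /\ (forall k, bmeas (y k)).
  by split=> i; [exact: bmeas_rcoord|exact: bmeas_icoord].
by apply: bmeasB; apply: bmeasZ; [apply: bmeasD|apply: bmeasB]; exact: bmeasM.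
Qed.

Lemma quad_form_real M z : M \is hermsymmx ->
  (z^t* *m M *m z) 0 0 = (quad_form M z)%:C%C.
Proof.
move=> Mh; rewrite /quad_form RRe_real //; apply/CrealP.
have wE : (z^t* *m M *m z)^t* = z^t* *m M *m z.
  by rewrite !trmx_mul !map_mxM /= trmxCK hermsymmx_trC // mulmxA.
by rewrite -[in RHS]wE !mxE.
Qed.

Lemma normc_real (r : R) : Normc.normc r%:C%C = `|r|.
Proof. by rewrite /= expr0n addr0 sqrtr_sqr. Qed.

(** [M = remx M + i immx M] with both parts Hermitian. Off-diagonal blocks of [xi] need not be
    Hermitian, while the moment bounds are for Hermitian forms. *)
Definition remx M : 'M[C]_d := 2^-1%:C%C *: (M + M^t*).
Definition immx M : 'M[C]_d := (0 -i* 2^-1)%C *: (M - M^t*).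

Lemma remxE M k l : remx M k l =
  (2^-1 * (complex.Re (M k l) + complex.Re (M l k))
   +i* (2^-1 * (complex.Im (M k l) - complex.Im (M l k))))%C.
Proof.
rewrite !mxE; case: (M k l) => a b; case: (M l k) => a' b'.
by apply/eqP; rewrite eq_complex /=; apply/andP; split; apply/eqP; ring.
Qed.

Lemma immxE M k l : immx M k l =
  (2^-1 * (complex.Im (M k l) + complex.Im (M l k))
   +i* (2^-1 * (complex.Re (M l k) - complex.Re (M k l))))%C.
Proof.
rewrite !mxE; case: (M k l) => a b; case: (M l k) => a' b'.
by apply/eqP; rewrite eq_complex /=; apply/andP; split; apply/eqP; ring.
Qed.

Lemma hermsymmxP M : (forall k l, M k l = Num.conj (M l k)) -> M \is hermsymmx.
Proof.
move=> ME; apply/is_hermitianmxP; rewrite expr0 scale1r.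
by apply/matrixP => k l; rewrite ME !mxE.
Qed.

Lemma remx_herm M : remx M \is hermsymmx.
Proof.
apply: hermsymmxP => k l; rewrite !remxE conjC_conjc.
by apply/eqP; rewrite eq_complex /=; apply/andP; split; apply/eqP; ring.
Qed.

Lemma immx_herm M : immx M \is hermsymmx.
Proof.
apply: hermsymmxP => k l; rewrite !immxE conjC_conjc.
by apply/eqP; rewrite eq_complex /=; apply/andP; split; apply/eqP; ring.
Qed.

Lemma quad_form_remx M z : quad_form (remx M) z = complex.Re ((z^t* *m M *m z) 0 0).
Proof.
rewrite -[RHS]/(quad_form M z) !quad_formE.
under eq_bigr => k _ do under eq_bigr => l _ do rewrite remxE /=.
(* The sides match only after symmetrisation: both are doubled, and one of the copies on the right
   has [k] and [l] exchanged. *)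
apply: (@mulfI _ 2) => //; rewrite [RHS]mulr_natl mulr2n [X in _ = X + _]exchange_big.
rewrite -big_split mulr_sumr; apply: eq_bigr => k _.
rewrite -big_split mulr_sumr; apply: eq_bigr => l _ /=.
by field.
Qed.

Lemma quad_form_immx M z : quad_form (immx M) z = complex.Im ((z^t* *m M *m z) 0 0).
Proof.
have -> : complex.Im ((z^t* *m M *m z) 0 0) = quad_form ((0 -i* 1)%C *: M) z.
  rewrite /quad_form -scalemxAr -scalemxAl; move: (z^t* *m M *m z) => W.
  by rewrite mxE; case: (W 0 0) => e f /=; ring.
rewrite !quad_formE.
under eq_bigr => k _ do under eq_bigr => l _ do rewrite immxE /=.
apply: (@mulfI _ 2) => //; rewrite [RHS]mulr_natl mulr2n [X in _ = X + _]exchange_big.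
rewrite -big_split mulr_sumr; apply: eq_bigr => k _.
rewrite -big_split mulr_sumr; apply: eq_bigr => l _ /=.
rewrite !mxE; case: (M k l) => a b; case: (M l k) => a' b' /=.
by field.
Qed.

(** Pythagoras: Hermitian and anti-Hermitian matrices are orthogonal for the real part of the
    Hilbert-Schmidt product. *)
Lemma frob_remx_immx M : frob (remx M) + frob (immx M) = frob M.
Proof.
apply: (@mulfI _ 2) => //; rewrite [RHS]mulr_natl mulr2n [X in _ = X + _]exchange_big.
rewrite -!big_split mulr_sumr; apply: eq_bigr => k _ /=.
rewrite -!big_split mulr_sumr; apply: eq_bigr => l _ /=.
by rewrite remxE immxE /sqmod /=; field.
Qed.

Lemma quad_form_sum (I : Type) (s : seq I) (F : I -> 'M[C]_d) z :
  quad_form (\sum_(i <- s) F i) z = \sum_(i <- s) quad_form (F i) z.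
Proof. by rewrite /quad_form mulmx_sumr mulmx_suml summxE raddf_sum. Qed.

(** Zero weight forces [M = 0]. This permits the weights [quad_weight] in [sqr_sum_le_weighted]. *)
Lemma quad_form_weight0 M z : quad_weight M = 0 -> quad_form M z = 0.
Proof.
rewrite /quad_weight => /eqP; rewrite paddr_eq0 ?sqr_ge0 ?frob_ge0 // => /andP[_].
rewrite psumr_eq0 => [/allP M0|k _]; last by apply: sumr_ge0 => l _; exact: sqmod_ge0.
rewrite quad_formE big1 // => k _; rewrite big1 // => l _.
have := M0 k (mem_index_enum _).
rewrite /= psumr_eq0 => [/allP/(_ l (mem_index_enum _))|l' _]; last exact: sqmod_ge0.
rewrite /= /sqmod paddr_eq0 ?sqr_ge0 // !sqrf_eq0 => /andP[/eqP-> /eqP->].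
by rewrite !mul0r subrr.
Qed.

End QuadForm.

(* If [w i = 0] then [a i ^+ 2 / w i] is the junk value [0], which is the right
   one here since [a i = 0]. *)
Lemma sqr_sum_le_weighted (R : realFieldType) (I : eqType) (s : seq I) (a w : I -> R) :
  (forall i, i \in s -> 0 <= w i) -> (forall i, i \in s -> w i = 0 -> a i = 0) ->
  (\sum_(i <- s) a i) ^+ 2 <= (\sum_(i <- s) w i) * \sum_(i <- s) a i ^+ 2 / w i.
Proof.
(* The square is expanded and each product [a i * a j] bounded by AM-GM; with [a i = w i * b] and
   [a j = w j * c] the gap is [w i * w j * (b - c)^2 / 2]. *)
move=> w0 a0; apply: (@le_trans _ _ (\sum_(i <- s) \sum_(j <- s)
    (2^-1 * (w j * (a i ^+ 2 / w i)) + 2^-1 * (w i * (a j ^+ 2 / w j))))).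
  rewrite expr2 mulr_suml big_seq [leRHS]big_seq; apply: ler_sum => i si.
  rewrite mulr_sumr big_seq [leRHS]big_seq; apply: ler_sum => j sj.
  have aw k : k \in s -> exists2 b, a k = w k * b & a k ^+ 2 / w k = w k * b ^+ 2.
    move=> sk; have [wk|wk] := eqVneq (w k) 0.
      by exists 0; rewrite a0 // wk ?mul0r // expr0n mul0r.
    by exists (a k / w k); field.
  have [b ai ->] := aw i si; have [c aj ->] := aw j sj.
  rewrite ai aj -subr_ge0.
  rewrite (_ : _ - _ = 2^-1 * (w i * w j * (b - c) ^+ 2)); last by field.
  apply: mulr_ge0; first by rewrite invr_ge0 ler0n.
  by apply: mulr_ge0; [apply: mulr_ge0; exact: w0|exact: sqr_ge0].
rewrite (eq_bigr (fun i => 2^-1 * ((\sum_(j <- s) w j) * (a i ^+ 2 / w i))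
    + 2^-1 * (w i * \sum_(j <- s) a j ^+ 2 / w j))) => [|i _]; last first.
  by rewrite big_split /= -!mulr_sumr -mulr_suml.
rewrite big_split /= -!mulr_sumr -mulr_suml le_eqVlt; apply/orP; left; apply/eqP.
by field.
Qed.

(** * Second moment of a sum of squares of Hermitian forms *)

Section SumOfSquares.
Variables (R : realType) (d : nat).
Variable mu : probability (cspace R d) R.
Hypothesis iso : isotropic mu.
Local Notation E := (sphere_mean mu).
Variable s : seq 'M[R[i]]_d.
Hypothesis sh : {in s, forall N, N \is hermsymmx}.

Definition sum_sqr_forms (z : 'cV[R[i]]_d) : R := \sum_(N <- s) quad_form N z ^+ 2.

Let T := \sum_(N <- s) quad_weight N.

Lemma bmeas_sum_sqr_forms : bmeas sum_sqr_forms.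
Proof. by apply: bmeas_sum => N; apply: bmeasX; exact: bmeas_quad_form. Qed.

Lemma mean_sum_sqr_forms : E sum_sqr_forms = T / (d%:R * (d + 1)%:R).
Proof.
rewrite mean_sum; last by move=> N; apply: bmeasX; exact: bmeas_quad_form.
rewrite mulr_suml; apply: eq_big_seq => N /sh Nh.
exact: mean_quad_form_sqr.
Qed.

(** Cauchy-Schwarz with the weights [W_N] bounds the square by [T] times the sum of [X_N^4 / W_N].
    Each fourth moment is at most [11 W_N^2 / Q], so the weights add up to [T] again and 11 is
    kept. *)
Lemma mean_sum_sqr_forms_sqr_le : E (fun z => sum_sqr_forms z ^+ 2) <=
  11 * T ^+ 2 / (d%:R * (d + 1)%:R * (d + 2)%:R * (d + 3)%:R).
Proof.
set Q := d%:R * _ * _ * _.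
have bq N : bmeas (fun z => quad_form N z ^+ 4 / quad_weight N).
  by apply: bmeasM; [apply: bmeasX; exact: bmeas_quad_form|exact: bmeas_cst].
apply: (@le_trans _ _ (E (fun z =>
    T * \sum_(N <- s) quad_form N z ^+ 4 / quad_weight N))).
  apply: le_mean; first by apply: bmeasX; exact: bmeas_sum_sqr_forms.
    by apply: bmeasZ; exact: bmeas_sum.
  move=> z _; apply: le_trans (sqr_sum_le_weighted (w := @quad_weight R d) _ _) _.
  - by move=> N _; exact: quad_weight_ge0.
  - by move=> N _ /quad_form_weight0 ->; rewrite expr0n.
  by rewrite -/T le_eqVlt; apply/orP; left; apply/eqP; congr (_ * _);
    apply: eq_bigr => N _; rewrite -exprM.
rewrite meanZ; last exact: bmeas_sum.
have T0 : 0 <= T by apply: sumr_ge0 => N _; exact: quad_weight_ge0.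
have -> : 11 * T ^+ 2 / Q = T * (11 / Q * T) by ring.
rewrite ler_wpM2l // mean_sum // /T mulr_sumr big_seq [leRHS]big_seq.
apply: ler_sum => N /sh Nh.
have -> : E (fun z => quad_form N z ^+ 4 / quad_weight N) =
    (quad_weight N)^-1 * E (fun z => quad_form N z ^+ 4).
  rewrite -meanZ; last by apply: bmeasX; exact: bmeas_quad_form.
  by apply: eq_mean => z _; rewrite mulrC.
have [->|w0] := eqVneq (quad_weight N) 0; first by rewrite invr0 !(mul0r, mulr0).
have wp : 0 < quad_weight N by rewrite lt_def w0 quad_weight_ge0.
rewrite mulrC ler_pdivrMr //; apply: le_trans (mean_quad_form_pow4_le iso Nh) _.
by rewrite -/Q le_eqVlt; apply/orP; left; apply/eqP; ring.
Qed.

End SumOfSquares.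

(** * Bipartite operators *)

Section Bipartite.
Variables (R : realType) (dA dB : nat).
Local Notation C := R[i].
Local Notation idx := (@mxtens_index dA dB).
Variable xi : 'M[C]_(dA * dB).
Hypothesis xih : xi \is hermsymmx.

Definition block (k l : 'I_dB) : 'M[C]_dA :=
  \matrix_(i, j) xi (idx (i, k)) (idx (j, l)).

(* The partial trace [Tr_A (xi *m (ketbra phi *t 1%:M))]. *)
Definition cond_mx (phi : 'cV[C]_dA) : 'M[C]_dB :=
  \matrix_(k, l) (phi^t* *m block k l *m phi) 0 0.

Lemma big_mxtens_index (V : nmodType) (F : 'I_(dA * dB) -> V) :
  \sum_u F u = \sum_i \sum_k F (idx (i, k)).
Proof.
rewrite pair_bigA /= (reindex_onto idx (@mxtens_unindex dA dB)) /=; last first.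
  by move=> u _; rewrite mxtens_unindexK.
by apply: eq_big => [[i k]|[i k] _] //; rewrite mxtens_indexK eqxx.
Qed.

Lemma block_conj k l i j : block k l i j = Num.conj (block l k j i).
Proof.
have := hermsymmx_trC xih => /matrixP/(_ (idx (i, k)) (idx (j, l))).
by rewrite !mxE => <-.
Qed.

Lemma sandwichE n (A : 'M[C]_n) (z : 'cV[C]_n) :
  (z^t* *m A *m z) 0 0 = \sum_i \sum_j Num.conj (z i 0) * A i j * z j 0.
Proof.
rewrite -mulmxA mxE; apply: eq_bigr => i _.
rewrite [(A *m z) _ _]mxE mulr_sumr; apply: eq_bigr => j _.
by rewrite !mxE mulrA.
Qed.

Lemma cond_mx_herm phi : cond_mx phi \is hermsymmx.
Proof.
apply: hermsymmxP => k l; rewrite [LHS]mxE [cond_mx phi l k]mxE !sandwichE.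
rewrite rmorph_sum exchange_big.
apply: eq_bigr => i _; rewrite rmorph_sum; apply: eq_bigr => j _.
by rewrite /= !rmorphM /= conjCK block_conj mulrC mulrA mulrAC.
Qed.

(** This separates the parties: for fixed [phi], the outcome density is a Hermitian form in
    [psi]. *)
Lemma mxtrace_ketbra phi psi :
  \tr (xi *m (ketbra phi *t ketbra psi)) = (psi^t* *m cond_mx phi *m psi) 0 0.
Proof.
rewrite sandwichE /mxtrace big_mxtens_index exchange_big /=.
apply: eq_bigr => k _.
under eq_bigr => i _ do rewrite mxE big_mxtens_index exchange_big /=.
rewrite exchange_big; apply: eq_bigr => l _ /=.
rewrite [cond_mx _ _ _]mxE sandwichE mulr_sumr mulr_suml; apply: eq_bigr => i _.
rewrite mulr_sumr mulr_suml; apply: eq_bigr => j _.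
rewrite tensmxE !mxE !big_ord1 !mxE; ring.
Qed.

(** The forms in [phi] whose squares add up to the weight of [cond_mx phi]: the partial trace over
    the second factor gives its trace, the other forms the real and imaginary parts of its
    entries. *)
Definition block_forms : seq 'M[C]_dA :=
  \sum_k block k k ::
  [seq remx (block kl.1 kl.2) | kl <- index_enum ('I_dB * 'I_dB)%type] ++
  [seq immx (block kl.1 kl.2) | kl <- index_enum ('I_dB * 'I_dB)%type].

Lemma block_forms_herm : {in block_forms, forall N, N \is hermsymmx}.
Proof.
move=> N; rewrite inE mem_cat => /or3P[/eqP->|/mapP[kl _ ->]|/mapP[kl _ ->]].
- apply: hermsymmxP => i j; rewrite !summxE rmorph_sum; apply: eq_bigr => k _.
  exact: block_conj.
- exact: remx_herm.
- exact: immx_herm.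
Qed.

Lemma quad_weight_cond_mx phi :
  quad_weight (cond_mx phi) = sum_sqr_forms block_forms phi.
Proof.
rewrite /sum_sqr_forms big_cons big_cat !big_map /= /quad_weight; congr (_ + _).
  rewrite quad_form_sum /mxtrace raddf_sum; congr (_ ^+ 2).
  by apply: eq_bigr => k _; rewrite mxE.
rewrite -big_split /frob pair_bigA; apply: eq_bigr => kl _ /=.
by rewrite quad_form_remx quad_form_immx mxE.
Qed.

(** The Frobenius parts of the weights of [remx] and [immx] already add up to [frob xi]; the weight
    of the partial trace and the squared traces are dropped. *)
Lemma frob_le_block_forms : frob xi <= \sum_(N <- block_forms) quad_weight N.
Proof.
rewrite big_cons big_cat !big_map /= -big_split /=.
have -> : frob xi = \sum_(kl : 'I_dB * 'I_dB) frob (block kl.1 kl.2).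
  rewrite -(pair_bigA _ (fun k l => frob (block k l))) /=.
  rewrite /frob (big_mxtens_index (fun u => \sum_v sqmod (xi u v))) exchange_big.
  apply: eq_bigr => k _ /=.
  under eq_bigr => i _ do
    rewrite (big_mxtens_index (fun v => sqmod (xi _ v))) exchange_big /=.
  rewrite exchange_big; apply: eq_bigr => l _ /=.
  by apply: eq_bigr => i _; apply: eq_bigr => j _; rewrite mxE.
rewrite -[leLHS]add0r lerD ?quad_weight_ge0 //; apply: ler_sum => kl _.
rewrite -frob_remx_immx lerD // lerDr sqr_ge0 //.
Qed.

End Bipartite.

(* [5 / 2] is a rational below the optimal constant [3 sqrt 3 / 2]. *)
Lemma norm_ge_quartic (R : realFieldType) (x tau : R) : 0 < tau ->
  5 / 2 * (x ^+ 2 / tau - x ^+ 4 / tau ^+ 3) <= `|x|.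
Proof.
move=> t0; pose u := `|x| / tau.
have u0 : 0 <= u by rewrite divr_ge0 // ltW.
have xE : `|x| = tau * u by rewrite /u mulrC divfK ?gt_eqF.
have -> : x ^+ 2 = (tau * u) ^+ 2 by rewrite -xE real_normK ?num_real.
have -> : x ^+ 4 = (tau * u) ^+ 4.
  by rewrite -xE (exprM _ 2 2) -(real_normK (num_real x)) -exprM.
rewrite xE -subr_ge0.
rewrite (_ : _ - _ = tau * (u * (1 - 5 / 2 * u + 5 / 2 * u ^+ 3))); last first.
  by field; rewrite gt_eqF.
rewrite mulr_ge0 ?(ltW t0) // mulr_ge0 //.
(* 29/50 approximates the minimiser [1 / sqrt 3] of the cubic, and [(u - c)^2 (u + 2 c) = u^3 - 3
   c^2 u + 2 c^3]. *)
have : 0 <= (u - 29 / 50) ^+ 2 * (u + 29 / 25).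
  by rewrite mulr_ge0 ?sqr_ge0 // addr_ge0 // divr_ge0.
nra.
Qed.

(** * Lower bound on the norm of the uniform product POVM *)

Section LowerBound.
Variables (R : realType) (dA dB : nat).
Variables (muA : probability (cspace R dA) R) (muB : probability (cspace R dB) R).
Hypotheses (isoA : isotropic muA) (isoB : isotropic muB).
Local Notation C := R[i].
Variable xi : 'M[C]_(dA * dB).
Hypothesis xih : xi \is hermsymmx.

Let F (phi : 'cV[C]_dA) : R :=
  sphere_mean muB (fun psi => `|quad_form (cond_mx xi phi) psi|).

Lemma UUnormE : UUnorm muA muB xi = (dA * dB)%:R * sphere_mean muA F.
Proof.
rewrite /UUnorm; congr (_ * _); apply: eq_Rintegral => phi _.
apply: eq_Rintegral => psi _.
by rewrite mxtrace_ketbra quad_form_real ?normc_real //; exact: cond_mx_herm.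
Qed.

Let S phi := sum_sqr_forms (block_forms xi) phi.

Let bS : bmeas S. Proof. exact: bmeas_sum_sqr_forms. Qed.

Let mean_cond_sqr phi :
  sphere_mean muB (fun psi => quad_form (cond_mx xi phi) psi ^+ 2) =
  S phi / (dB%:R * (dB + 1)%:R).
Proof.
by rewrite mean_quad_form_sqr ?quad_weight_cond_mx //; exact: cond_mx_herm.
Qed.

(** Boundedness follows from [|x| <= 1 + x^2] and the second moment in [psi], measurability from
    Tonelli. *)
Let bmeas_F : bmeas F.
Proof.
split; last first.
  have [_ [K SK]] := bS.
  exists (1 + K / (dB%:R * (dB + 1)%:R)) => phi Sphi.
  rewrite ger0_norm; last by apply: mean_ge0.
  apply: (@le_trans _ _ (sphere_mean muB
      (fun psi => 1 + quad_form (cond_mx xi phi) psi ^+ 2))).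
    apply: le_mean.
    - by apply: bmeas_norm; exact: bmeas_quad_form.
    - by apply: bmeasD; [exact: bmeas_cst|apply: bmeasX; exact: bmeas_quad_form].
    move=> psi _; rewrite -[X in 1 + X]real_normK ?num_real //.
    have : 0 <= (`|quad_form (cond_mx xi phi) psi| - 2^-1) ^+ 2 by exact: sqr_ge0.
    nra.
  rewrite meanD ?mean_cst //; last 2 first.
  - exact: bmeas_cst.
  - by apply: bmeasX; exact: bmeas_quad_form.
  rewrite mean_cond_sqr lerD2l ler_wpM2r ?invr_ge0 ?mulr_ge0 ?ler0n //.
  exact: le_trans (ler_norm _) (SK _ Sphi).
(* The indicator turns the inner integral over the sphere into one over the whole space. *)
pose f (w : cspace R dA * cspace R dB) : \bar R :=
  (`|quad_form (cond_mx xi w.1) w.2| * \1_(unit_vectors R dB) w.2)%:E.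
have mf : measurable_fun [set: cspace R dA * cspace R dB] f.
  apply/measurable_EFinP; apply: measurable_funM; last first.
    apply: measurableT_comp => //.
    by apply: measurable_indic; exact: measurable_unit_vectors.
  apply: measurableT_comp => //.
  (* The form is a finite sum of products of a function of [phi] and a function of [psi], hence
     jointly measurable. *)
  rewrite (_ : (fun _ => _) = fun w => \sum_k \sum_l
    (quad_form (remx (block xi k l)) w.1 *
       (rcoord k w.2 * rcoord l w.2 + icoord k w.2 * icoord l w.2)
     - quad_form (immx (block xi k l)) w.1 *
       (rcoord k w.2 * icoord l w.2 - icoord k w.2 * rcoord l w.2))); last first.
    apply/funext => w; rewrite quad_formE; apply: eq_bigr => k _.
    by apply: eq_bigr => l _; rewrite quad_form_remx quad_form_immx !mxE.
  have m1 g : bmeas g -> measurable_fun setT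
      ((fun w : cspace R dA * cspace R dB => g w.1) : _ -> R).
    by move=> [mg _]; apply: (measurableT_comp mg measurable_fst).
  have m2 g : bmeas g -> measurable_fun setT
      ((fun w : cspace R dA * cspace R dB => g w.2) : _ -> R).
    by move=> [mg _]; apply: (measurableT_comp mg measurable_snd).
  apply: measurable_sum => k; apply: measurable_sum => l.
  have bx i : bmeas (@rcoord R dB i) by exact: bmeas_rcoord.
  have by_ i : bmeas (@icoord R dB i) by exact: bmeas_icoord.
  apply: measurable_funB; apply: measurable_funM.
  - by apply: m1; exact: bmeas_quad_form.
  - by apply: (m2 (fun z => rcoord k z * rcoord l z + icoord k z * icoord l z));
      apply: bmeasD; exact: bmeasM.
  - by apply: m1; exact: bmeas_quad_form.
  - by apply: (m2 (fun z => rcoord k z * icoord l z - icoord k z * rcoord l z));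
      apply: bmeasB; exact: bmeasM.
have f0 w : (0 <= f w)%E by rewrite lee_fin mulr_ge0 // indicE ler0n.
have mF : measurable_fun [set: cspace R dA] (fubini_F muB f).
  exact: measurable_fun_fubini_tonelli_F.
rewrite (_ : F = fine \o fubini_F muB f); first exact: measurableT_comp mF.
apply/funext => phi; rewrite /F /sphere_mean /Rintegral /= /fubini_F; congr fine.
rewrite [LHS]integral_mkcond; apply: eq_integral => psi _.
rewrite /f /patch indicE; case: ifP => _; first by rewrite mulr1.
by rewrite mulr0.
Qed.

Lemma frob_UUnorm : Num.sqrt (frob xi) <= Num.sqrt 153 * UUnorm muA muB xi.
Proof.
pose T := \sum_(N <- block_forms xi) quad_weight N.
have frT : frob xi <= T by exact: frob_le_block_forms.
have UU0 : 0 <= UUnorm muA muB xi.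
  rewrite UUnormE mulr_ge0 ?ler0n //; apply: mean_ge0 => phi _.
  by apply: mean_ge0.
(* For [T <= 0] no positive [tau] would result, but then [frob xi <= 0] and the left side is 0. *)
have [T0|T0] := leP T 0.
  rewrite (ler0_sqrtr (le_trans frT T0)).
  by apply: mulr_ge0 => //; exact: sqrtr_ge0.
pose s := Num.sqrt T.
have s0 : 0 < s by rewrite sqrtr_gt0.
have sT : s ^+ 2 = T by rewrite sqr_sqrtr // ltW.
pose a : R := dA%:R; pose b : R := dB%:R.
have a0 : 0 < a by rewrite ltr0n; exact: isotropic_dim_gt0 isoA.
have b0 : 0 < b by rewrite ltr0n; exact: isotropic_dim_gt0 isoB.
(* The optimal multiple of [s / ((a + 1) * (b + 1))] is [sqrt 363], about [19.05]. *)
pose tau := 20 * s / ((a + 1) * (b + 1)).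
have tau0 : 0 < tau by rewrite divr_gt0 ?mulr_gt0 ?addr_gt0.
pose qB := b * (b + 1); pose rB := b * (b + 1) * (b + 2) * (b + 3).
pose qA := a * (a + 1); pose rA := a * (a + 1) * (a + 2) * (a + 3).
(* The quartic bound is averaged over [psi] with one [tau] for all [phi], so that averaging over
   [phi] involves only the first two moments of [S]. *)
have Flb phi : 5 / 2 * (S phi / qB / tau - 11 * S phi ^+ 2 / rB / tau ^+ 3) <= F phi.
  set M := cond_mx xi phi.
  have bq : bmeas (quad_form M) by exact: bmeas_quad_form.
  have b2 : bmeas (fun psi => tau^-1 * quad_form M psi ^+ 2).
    by apply: bmeasZ; exact: bmeasX.
  have b4 : bmeas (fun psi => tau ^- 3 * quad_form M psi ^+ 4).
    by apply: bmeasZ; exact: bmeasX.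
  apply: (@le_trans _ _ (sphere_mean muB (fun psi => 5 / 2 *
      (tau^-1 * quad_form M psi ^+ 2 - tau ^- 3 * quad_form M psi ^+ 4)))).
    rewrite meanZ; last exact: bmeasB.
    rewrite meanB // !meanZ; [|exact: bmeasX|exact: bmeasX].
    rewrite mean_cond_sqr ler_wpM2l ?divr_ge0 // lerB //.
      by rewrite /qB natrD mulrC.
    rewrite mulrC ler_wpM2r ?invr_ge0 ?exprn_ge0 ?(ltW tau0) //.
    apply: le_trans (mean_quad_form_pow4_le isoB (cond_mx_herm xih phi)) _.
    by rewrite quad_weight_cond_mx /rB !natrD.
  apply: le_mean; [by apply: bmeasZ; exact: bmeasB|exact: bmeas_norm|].
  move=> psi _; apply: le_trans (norm_ge_quartic _ tau0).
  by rewrite [tau^-1 * _]mulrC [tau^-3 * _]mulrC.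
have bS2 : bmeas (fun phi => S phi ^+ 2) by exact: bmeasX.
have Elb : 5 / 2 * (T / qA / qB / tau - 11 * (11 * T ^+ 2 / rA) / rB / tau ^+ 3)
    <= sphere_mean muA F.
  have b1 := bmeasZ (qB * tau)^-1 bS.
  have b2 := bmeasZ (11 / (rB * tau ^+ 3)) bS2.
  have b12 := bmeasZ (5 / 2) (bmeasB b1 b2).
  apply: (@le_trans _ _ (sphere_mean muA (fun phi =>
     5 / 2 * ((qB * tau)^-1 * S phi - 11 / (rB * tau ^+ 3) * S phi ^+ 2)))); last first.
    apply: le_mean => // phi _.
    apply: le_trans (Flb phi).
    rewrite le_eqVlt; apply/orP; left; apply/eqP; rewrite !invfM; ring.
  rewrite meanZ; last exact: bmeasB b1 b2.
  rewrite (meanB _ b1 b2) (meanZ _ _ bS) (meanZ _ _ bS2).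
  rewrite (mean_sum_sqr_forms isoA (block_forms_herm xih)) -/T.
  have := mean_sum_sqr_forms_sqr_le isoA (block_forms_herm xih).
  rewrite -/T !natrD -/a -/qA -/rA => E2.
  rewrite ler_wpM2l ?divr_ge0 // lerB //.
    by rewrite [(qB * tau)^-1]invfM le_eqVlt; apply/orP; left; apply/eqP; ring.
  apply: (@le_trans _ _ (11 / (rB * tau ^+ 3) * (11 * T ^+ 2 / rA))); last first.
    by rewrite [(rB * tau ^+ 3)^-1]invfM le_eqVlt; apply/orP; left; apply/eqP; ring.
  rewrite ler_wpM2l // divr_ge0 // mulr_ge0 ?exprn_ge0 ?(ltW tau0) //.
  by rewrite /rB !mulr_ge0 ?addr_ge0 ?(ltW b0).
have sU : 12^-1 * s <= UUnorm muA muB xi.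
  rewrite UUnormE natrM -/a -/b.
  apply: le_trans (ler_wpM2l _ Elb); last by rewrite mulr_ge0 ?ltW.
  (* The cube comes from [tau^3]. Bounding these ratios by 1 makes the constant independent of the
     dimensions. *)
  have h_le (c : R) : 0 < c ->
      0 <= c * (c + 1) ^+ 3 / (c * (c + 1) * (c + 2) * (c + 3)) <= 1.
    move=> c0; have q0 : 0 < c * (c + 1) * (c + 2) * (c + 3).
      by rewrite !mulr_gt0 ?addr_gt0.
    rewrite divr_ge0 ?(ltW q0) ?mulr_ge0 ?exprn_ge0 ?addr_ge0 ?(ltW c0) //=.
    rewrite ler_pdivrMr // mul1r -subr_ge0.
    rewrite (_ : _ - _ = c * (c + 1) * (3 * c + 5)); last by ring.
    by rewrite !mulr_ge0 ?addr_ge0 ?mulr_ge0 ?(ltW c0).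
  have /andP[hA0 hA1] := h_le a a0; have /andP[hB0 hB1] := h_le b b0.
  have hAB := mulr_ile1 hA0 hB0 hA1 hB1.
  rewrite (_ : a * b * _ = 5 / 2 * s * (1 / 20 - 121 / 20 / 400 *
      (a * (a + 1) ^+ 3 / (a * (a + 1) * (a + 2) * (a + 3)) *
      (b * (b + 1) ^+ 3 / (b * (b + 1) * (b + 2) * (b + 3)))))); last first.
    rewrite /tau /qA /qB /rA /rB -sT; field.
    by rewrite !gt_eqF ?addr_gt0.
  (* At [h = 1] the coefficient of [s] is [5/2 (1/20 - 121/8000) = 279/3200], above [1/12]. *)
  move: hAB; move: (_ * _ / _ * (_ / _)) => h h1.
  have : 0 <= s * (1 - h) by rewrite mulr_ge0 ?subr_ge0 ?(ltW s0).
  by lra.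
rewrite -ler_pdivrMl ?sqrtr_gt0 //; apply: le_trans sU.
rewrite ler_pM ?invr_ge0 ?sqrtr_ge0 ?ler_wsqrtr //.
rewrite lef_pV2 ?posrE ?sqrtr_gt0 //.
(* Since [12^2 = 144 <= 153]. *)
by rewrite -(@ler_pXn2r _ 2) ?nnegrE ?sqrtr_ge0 // sqr_sqrtr //; lra.
Qed.

End LowerBound.

(** * Trace norm against Hilbert-Schmidt norm, and conclusion *)

Lemma hsnormE (R : realType) n (A : 'M[R[i]]_n) : hsnorm A = Num.sqrt (frob A).
Proof. by rewrite /hsnorm Re_mxtrace_gram. Qed.

(** With [B] the square root of the Gram matrix of [A], the trace norm is a sum of [n] diagonal
    entries of [B]. Cauchy-Schwarz applies, and [B] has the Hilbert-Schmidt norm of [A]. *)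
Lemma trnorm_le_hsnorm (R : realType) n (A : 'M[R[i]]_n) :
  trnorm A <= Num.sqrt n%:R * hsnorm A.
Proof.
rewrite /hsnorm -sqrtrM ?ler0n // -[leLHS]ger0_norm ?trnorm_ge0 //.
rewrite -sqrtr_sqr ler_wsqrtr //.
have gpsd := psdmx_gram A; have [Bh _] := sqrtmx_psd gpsd.
have -> : complex.Re (\tr (A^t* *m A)) = frob (sqrtmx (A^t* *m A)).
  by rewrite -Re_mxtrace_gram (hermsymmx_trC Bh) sqrtmxK.
rewrite /trnorm; move: (sqrtmx _) => B; rewrite /mxtrace raddf_sum.
apply: le_trans (sqr_sum_le_weighted (w := fun=> 1) _ _) _ => //.
  by move=> i _ /eqP; rewrite oner_eq0.
rewrite sumr_const cardT size_enum_ord ler_wpM2l ?ler0n //.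
apply: ler_sum => i _; rewrite divr1 (bigD1 i) //= ler_wpDr ?lerDl ?sqr_ge0 //.
by apply: sumr_ge0 => j _; exact: sqmod_ge0.
Qed.

Theorem theorem15 (R : realType) (dA dB : nat)
  (muA : probability (cspace R dA) R) (muB : probability (cspace R dB) R)
  (isoA : isotropic muA) (isoB : isotropic muB) :
  (forall rho sigma : 'M[R[i]]_(dA * dB), is_state rho -> is_state sigma ->
     let xi := rho - sigma in
     UUnorm muA muB xi >= (Num.sqrt 153)^-1 * hsnorm xi /\
     (Num.sqrt 153)^-1 * hsnorm xi >=
       (Num.sqrt (153 * (dA * dB)%:R))^-1 * trnorm xi) /\
  (lambda muA muB >= ((Num.sqrt (153 * (dA * dB)%:R))^-1)%:E)%E.
Proof.
have D0 : 0 < (dA * dB)%:R :> R.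
  by rewrite ltr0n muln_gt0 (isotropic_dim_gt0 isoA) (isotropic_dim_gt0 isoB).
have UU_hs (xi : 'M[R[i]]_(dA * dB)) : xi \is hermsymmx ->
    (Num.sqrt 153)^-1 * hsnorm xi <= UUnorm muA muB xi.
  by move=> xih; rewrite ler_pdivrMl ?sqrtr_gt0 // hsnormE; exact: frob_UUnorm.
have hs_tr (xi : 'M[R[i]]_(dA * dB)) :
    (Num.sqrt (153 * (dA * dB)%:R))^-1 * trnorm xi <= (Num.sqrt 153)^-1 * hsnorm xi.
  rewrite sqrtrM // invfM -mulrA ler_wpM2l ?invr_ge0 ?sqrtr_ge0 //.
  by rewrite ler_pdivrMl ?sqrtr_gt0 //; exact: trnorm_le_hsnorm.
split=> [rho sigma [[rhoh _] _] [[sigmah _] _] xi|].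
  split; last exact: hs_tr.
  apply: UU_hs; apply: hermsymmxP => k l.
  have := hermsymmx_trC rhoh; have := hermsymmx_trC sigmah.
  move=> /matrixP/(_ k l) + /matrixP/(_ k l).
  by rewrite !mxE rmorphB => <- <-.
(* Chaining the two inequalities makes the constant admissible, hence at most the supremum. *)
apply: ereal_sup_ubound; exists (Num.sqrt (153 * (dA * dB)%:R))^-1 => //.
by move=> xi xih _; exact: le_trans (hs_tr xi) (UU_hs xi xih).
Qed.
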